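(* As $N\to\infty$, $$\bigl(E(N)+N^2(\log N)^2\bigr)\left(\int_0^1|S(\alpha)|\,d\alpha+O\bigl(N^{1/2}(\log\log N)^{1/2}\bigr)\right)^2\gg N^3(\log N)^3.$$ That is, there exist absolute constants $C>0$ and $c>0$ such that for all sufficiently large $N$, $$\bigl(E(N)+N^2(\log N)^2\bigr)\left(\int_0^1|S(\alpha)|\,d\alpha+C\,N^{1/2}(\log\log N)^{1/2}\right)^2\ge c\,N^3(\log N)^3.$$
   Context: $N$ denotes a positive integer, $e(u)=e^{2\pi i u}$, and $\Lambda$ is the von Mangoldt function. Set $S(\alpha)=\sum_{n\le N}\Lambda(n)e(n\alpha)$ (which depends on $N$) and, for an integer $k$, $\psi_2(N,k)=\sum_{1\le n,n'\le N,\ n'-n=k}\Lambda(n)\Lambda(n')$. For nonzero integers $k$, the singular series is $\mathfrak S(k)=2C_2\prod_{p\mid k,\ p>2}\frac{p-1}{p-2}$ if $k$ is even, and $\mathfrak S(k)=0$ if $k$ is odd, where $C_2=\prod_{p>2}\left(1-\frac{1}{(p-1)^2}\right)$ and $p$ runs over primes. Define $$E(N)=\sum_{1\le|k|\le N}\bigl(\psi_2(N,k)-\mathfrak S(k)(N-|k|)\bigr)^2.$$ *)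

(* Defs.v *)
From mathcomp Require Import all_boot all_order all_algebra.
From mathcomp Require Import all_classical all_reals all_analysis.
From mathcomp Require Export complex.
Set Implicit Arguments.
Unset Strict Implicit.
Unset Printing Implicit Defensive.
Import Order.TTheory GRing.Theory Num.Theory.
Import numFieldNormedType.Exports.
Local Open Scope classical_set_scope.
Local Open Scope ring_scope.

Section Definitions.
Variable R : realType.

(* [primes n] is the duplicate-free list of the prime divisors of n, so it is
   [:: p] exactly when n = p ^ k with p prime and k >= 1. *)
Definition vonMangoldt (n : nat) : R :=
  if primes n is [:: p] then ln p%:R else 0.

(* e(u) = exp(2 pi i u). *)
Definition exp2pii (u : R) : R[i] :=
  Complex (cos (2 * pi * u)) (sin (2 * pi * u)).

Definition expsum (N : nat) (alpha : R) : R[i] :=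
  \sum_(1 <= n < N.+1) real_complex R (vonMangoldt n) * exp2pii (n%:R * alpha).

Definition psi2 (N : nat) (k : int) : R :=
  \sum_(1 <= n < N.+1)
    \sum_(1 <= n' < N.+1 | n'%:Z - n%:Z == k) vonMangoldt n * vonMangoldt n'.

(* C_2. The partial products are positive and nonincreasing, so the limit exists. *)
Definition twin_const : R :=
  limn (fun n => \prod_(3 <= p < n | prime p) (1 - 1 / (p%:R - 1) ^+ 2) : R).

(* Meaningful for k != 0 only: the value at k = 0 is not used. *)
Definition singular_series (k : int) : R :=
  if (2 %| `|k|)%N then
    2 * twin_const * \prod_(p <- primes `|k| | (2 < p)%N) ((p%:R - 1) / (p%:R - 2))
  else 0.

(* E(N). The sum over 1 <= |k| <= N, with the terms k = h and k = - h grouped. *)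
Definition pair_error (N : nat) : R :=
  \sum_(1 <= h < N.+1) \sum_(k <- [:: h%:Z; - h%:Z])
    (psi2 N k - singular_series k * (N%:R - `|k|%:~R)) ^+ 2.

End Definitions.

(* Main.v *)
(* Let S(th) = sum_(n <= N) Lambda(n) e(n th), l = log N and X = N l. Writing the
   singular series as a divisor sum S(k) = sum_(2d | k) u(d) with u >= 0 turns the
   expected value of |S|^2 into a nonnegative combination of Fejer-type kernels:
   |S|^2 = B + V + c0, where B has mean square E(N), c0 is a constant, and
   V = sum_d u(d) G_2d with G_m(th) = sum_(n = n' mod m) e((n - n') th).
   Cut V at Z ~ sqrt(N / l). The part d > Z has mean square O(X^2). The part
   d <= Z has mean at most (5/8 + o(1)) X, and it exceeds X only on a set of
   measure O(1 / l), by a weak-type estimate for 1 / sin^2. Chebyshev's bound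
   sum Lambda^2 >= 0.66 X then shows that, outside this set, |S|^2 still has mean
   >> X unless E(N) >> X^2 l, in which case the claim is trivial, whereas |S|^4 has
   mean O(E(N) + X^2 + (sum Lambda^2)^2). Hoelder's inequality between the
   exponents 1, 2 and 4 concludes. All the means are averages over the points
   2 pi j / M, and M tends to infinity at the end. *)
Require Import Defs.
From mathcomp Require Import all_boot all_order all_algebra.
From mathcomp Require Import all_classical all_reals all_analysis.
From mathcomp Require Import ring lra zify.
Set Implicit Arguments.
Unset Strict Implicit.
Unset Printing Implicit Defensive.
Import Order.TTheory GRing.Theory Num.Theory.
Import numFieldNormedType.Exports.
Local Open Scope classical_set_scope.
Local Open Scope ring_scope.

(** * Squarefree numbers and multiplicative functions *)

(** The explicit numbers serve a thin margin. Even if all the mass of the part d <= Z lies on the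
    exceptional set, |S|^2 keeps about (0.66 - 5/8) X elsewhere, so crude values of the two
    constants do not suffice (asymptotically they are 1 and 1/2). The whole of V has mean about X
    and could absorb the entire diagonal; taking Z ~ sqrt(N / l) halves log Z and with it the mean.
    The measure O(1 / l) is what Cauchy-Schwarz asks for: over the exceptional set |B| has integral
    at most the square root of E(N) times the measure, a small multiple of X when E(N) <= eps X^2 l.
    Above this threshold the added term N^(1/2) (log log N)^(1/2) is enough, as its square is at
    least N and E(N) N >= eps X^3. Markov's inequality for V gives only measure O(1). The gain comes
    from G_2d(th) <= 2 d / sin^2(d th); since 1 / sin^2 is not integrable it is cut at height J^2 ~
    X, and then J Z ~ N. The means to be evaluated are those of trigonometric polynomials of degree
    below M, for which the grid is exact; integration enters only for |S| itself. *)

Definition sqfree (n : nat) : bool :=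
  (0 < n)%N && all (fun p => logn p n == 1%N) (primes n).

Lemma sqfree_gt0 n : sqfree n -> (0 < n)%N.
Proof. by case/andP. Qed.

Lemma sqfreeP n : (0 < n)%N ->
  reflect (forall p, prime p -> ~~ (p ^ 2 %| n)%N) (sqfree n).
Proof.
move=> n0; rewrite /sqfree n0 /=; apply: (iffP allP) => [H p pp|H p].
  rewrite pfactor_dvdn // -ltnNge ltnS; have [pn|pn] := boolP (p \in primes n).
    by rewrite (eqP (H p pn)).
  by move: pn; rewrite -logn_gt0 -eqn0Ngt => /eqP->.
move=> pn; have pp : prime p by move: pn; rewrite mem_primes => /andP[].
move: (H p pp); rewrite pfactor_dvdn // -ltnNge ltnS => h.
by rewrite eqn_leq h /= logn_gt0.
Qed.

Lemma sqfree_logn n p : sqfree n -> p \in primes n -> logn p n = 1%N.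
Proof. by case/andP=> _ /allP H /H /eqP. Qed.

Lemma sqfree_prod n : sqfree n -> n = (\prod_(p <- primes n) p)%N.
Proof.
case/andP => n0 /allP H; rewrite {1}(prod_prime_decomp n0) prime_decompE.
rewrite big_map; apply: eq_big_seq => p /H /eqP -> /=.
by rewrite expn1.
Qed.

Lemma sqfree_mull a b : sqfree (a * b) -> sqfree a.
Proof.
move=> H; have := sqfree_gt0 H; rewrite muln_gt0 => /andP[a0 b0].
apply/(sqfreeP a0) => p pp; move/(sqfreeP (sqfree_gt0 H)): H => /(_ _ pp).
by apply: contra => /dvdn_mulr.
Qed.

Lemma sqfree_coprime a b : sqfree (a * b) -> coprime a b.
Proof.
move=> H; have := sqfree_gt0 H; rewrite muln_gt0 => /andP[a0 b0].
rewrite coprime_has_primes //; apply/hasPn => p.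
rewrite mem_primes => /and3P[pp _ pb]; apply/negP; rewrite mem_primes.
case/and3P=> _ _ pa; move/(sqfreeP (sqfree_gt0 H)): H => /(_ _ pp).
by rewrite expnS expn1 dvdn_mul.
Qed.

Lemma sqfree_mul a b : sqfree a -> sqfree b -> coprime a b -> sqfree (a * b).
Proof.
move=> sa sb cab; have a0 := sqfree_gt0 sa; have b0 := sqfree_gt0 sb.
rewrite /sqfree muln_gt0 a0 b0 /=; apply/allP => p.
rewrite primesM // lognM // => /orP[pa|pb].
  rewrite (sqfree_logn sa pa).
  have : ~~ (p \in primes b).
    by move: cab; rewrite coprime_sym coprime_has_primes // => /hasPn/(_ p pa).
  by rewrite -logn_gt0 -eqn0Ngt => /eqP ->.
rewrite (sqfree_logn sb pb).
have : ~~ (p \in primes a).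
  by move: cab; rewrite coprime_has_primes // => /hasPn/(_ p pb).
by rewrite -logn_gt0 -eqn0Ngt => /eqP ->.
Qed.

Lemma dvdn_prod (s : seq nat) (f g : nat -> nat) :
  (forall p, p \in s -> (f p %| g p)%N) ->
  (\prod_(p <- s) f p %| \prod_(p <- s) g p)%N.
Proof.
elim: s => [|p s IH] H; first by rewrite !big_nil.
rewrite !big_cons dvdn_mul ?H ?mem_head ?IH // => q qs.
by rewrite H // inE qs orbT.
Qed.

Section MultiplicativeFunctions.
Variable R : realFieldType.
Implicit Types F : nat -> R.

Definition mprod F (n : nat) : R := \prod_(p <- primes n) F p.

Lemma mprod1 F : mprod F 1 = 1.
Proof. by rewrite /mprod big_nil. Qed.

Lemma mprod_prime F p : prime p -> mprod F p = F p.
Proof. by move=> pp; rewrite /mprod primes_prime // big_seq1. Qed.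

Lemma mprod_ge0 F n : (forall p, prime p -> 0 <= F p) -> 0 <= mprod F n.
Proof.
move=> F0; rewrite /mprod big_seq; apply: prodr_ge0 => p.
by rewrite mem_primes => /andP[/F0].
Qed.

Lemma eq_mprod F G n : (forall p, prime p -> (p %| n)%N -> F p = G p) ->
  mprod F n = mprod G n.
Proof.
move=> FG; apply: eq_big_seq => p.
by rewrite mem_primes => /and3P[pp _ pn]; apply: FG.
Qed.

Lemma mprodM F G n : mprod F n * mprod G n = mprod (fun p => F p * G p) n.
Proof. by rewrite /mprod -big_split. Qed.

Lemma mprod_mul F a b : (0 < a)%N -> (0 < b)%N -> coprime a b ->
  mprod F (a * b) = mprod F a * mprod F b.
Proof.
move=> a0 b0 cab; rewrite /mprod -big_cat; apply: perm_big.
apply: uniq_perm; rewrite ?primes_uniq // ?cat_uniq ?primes_uniq ?andbT /=.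
  by move: cab; rewrite coprime_has_primes //.
by move=> p; rewrite mem_cat primesM.
Qed.

Lemma mprod_id n : sqfree n -> mprod (fun p => p%:R) n = n%:R.
Proof. by move=> sn; rewrite {2}(sqfree_prod sn) /mprod natr_prod. Qed.

(** Mirrors the expansion of [\prod_(p <- ps) (1 + F p)]: each prime is skipped or taken, which
    makes [prod1D_sqdivs] an induction on the list. *)
Fixpoint sqdivs (ps : seq nat) : seq nat :=
  if ps is p :: ps' then sqdivs ps' ++ [seq (p * d)%N | d <- sqdivs ps']
  else [:: 1%N].

Lemma mem_sqdivs ps d : uniq ps -> all prime ps ->
  (d \in sqdivs ps) = sqfree d && all (mem ps) (primes d).
Proof.
elim: ps d => [|p ps IH] d /=.
  rewrite inE => _ _; apply/eqP/andP => [->//|[sd /allP H]].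
  case/andP: sd => d0 _; apply/eqP; rewrite eqn_leq d0 andbT leqNgt.
  by apply/negP => /pdivP[q qp qd]; have := H q; rewrite mem_primes qp d0 qd => /(_ isT).
case/andP=> pps ups /andP[pp aps]; rewrite mem_cat; apply/idP/idP.
  case/orP.
    rewrite IH // => /andP[-> /allP H] /=; apply/allP => q /H /= qps.
    by rewrite inE; apply/orP; right.
  case/mapP => e; rewrite IH // => /andP[se /allP H] ->.
  have e0 := sqfree_gt0 se; have p0 := prime_gt0 pp.
  have cpe : coprime p e.
    rewrite prime_coprime //; apply/negP => pe.
    by have := H p; rewrite mem_primes pp e0 pe => /(_ isT) /= ; apply/negP.
  rewrite sqfree_mul //=; last first.
    by rewrite /sqfree p0 /= primes_prime //= logn_prime // eqxx.
  apply/allP => q; rewrite primesM // primes_prime // mem_seq1 => /orP[/eqP->|].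
    exact: mem_head.
  by move=> /H /=; rewrite inE => ->; rewrite orbT.
case/andP=> sd /allP H; have d0 := sqfree_gt0 sd.
have [pd|npd] := boolP (p %| d)%N; last first.
  apply/orP; left; rewrite IH // sd /=; apply/allP => q qd.
  move: (H q qd); rewrite inE /= => /orP[/eqP qp|//].
  by move: qd npd; rewrite qp mem_primes => /and3P[_ _ ->].
apply/orP; right; case/dvdnP: pd => e de.
have sep : sqfree (e * p) by rewrite -de.
have se := sqfree_mull sep; have cep := sqfree_coprime sep.
apply/mapP; exists e; last by rewrite mulnC.
rewrite IH // se /=; apply/allP => q qe.
have : q \in p :: ps.
  by apply: H; rewrite de primesM ?qe // ?(sqfree_gt0 se) // prime_gt0.
rewrite inE /= => /orP[/eqP qp|//].
move: cep; rewrite coprime_sym prime_coprime // -qp.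
by move: qe; rewrite mem_primes => /and3P[_ _ ->].
Qed.

Lemma sqdivs_uniq ps : uniq ps -> all prime ps -> uniq (sqdivs ps).
Proof.
elim: ps => [|p ps IH] //= /andP[pps ups] /andP[pp aps].
have p0 := prime_gt0 pp.
rewrite cat_uniq IH // map_inj_uniq ?IH //; last first.
  by move=> a b /eqP; rewrite eqn_pmul2l // => /eqP.
rewrite andbT /=; apply/hasPn => _ /mapP[e esq ->]; apply/negP => /=.
move: esq; rewrite !mem_sqdivs // => /andP[se _] /andP[_ /allP/(_ p)] /=.
rewrite mem_primes pp muln_gt0 p0 (sqfree_gt0 se) dvdn_mulr // => /(_ isT).
exact/negP.
Qed.

Lemma prod1D_sqdivs F ps : uniq ps -> all prime ps ->
  \prod_(p <- ps) (1 + F p) = \sum_(d <- sqdivs ps) mprod F d.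
Proof.
elim: ps => [|p ps IH] /=; first by rewrite !big_nil big_seq1 mprod1.
case/andP=> pps ups /andP[pp aps]; rewrite big_cons big_cat /= IH // mulrDl mul1r.
congr (_ + _); rewrite big_map mulr_sumr; apply: eq_big_seq => e.
rewrite mem_sqdivs // => /andP[se /allP H].
have p0 := prime_gt0 pp; have e0 := sqfree_gt0 se.
have cpe : coprime p e.
  rewrite prime_coprime //; apply/negP => pe.
  by have := H p; rewrite mem_primes pp e0 pe => /(_ isT) /=; apply/negP.
by rewrite mprod_mul // (mprod_prime _ pp).
Qed.

(** The range of d is bounded by N rather than by n, so that this sum can be exchanged with an outer
    sum over n. *)
Lemma mprod1D F N n : (0 < n <= N)%N ->
  mprod (fun p => 1 + F p) n =
  \sum_(1 <= d < N.+1 | sqfree d && (d %| n)%N) mprod F d.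
Proof.
case/andP=> n0 nN; have aps : all prime (primes n).
  by apply/allP => p; rewrite mem_primes => /and3P[].
rewrite /mprod prod1D_sqdivs ?primes_uniq //.
rewrite -[RHS]big_filter; apply: perm_big; apply: uniq_perm.
- by rewrite sqdivs_uniq ?primes_uniq.
- by rewrite filter_uniq // iota_uniq.
move=> d; rewrite mem_sqdivs ?primes_uniq // mem_filter mem_index_iota.
apply/andP/idP => [[sd /allP H]|/andP[/andP[sd dn] _]].
  rewrite sd ltnS (sqfree_gt0 sd) /=.
  have dn : (d %| n)%N.
    have nE : (\prod_(p <- primes n) p ^ logn p n)%N = n.
      by rewrite [RHS]prod_prime_decomp // prime_decompE big_map.
    rewrite (sqfree_prod sd) -[X in (_ %| X)%N]nE.
    have -> : (\prod_(p <- primes d) p = \prod_(p <- primes n) (if p \in primes d then p else 1))%N.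
      rewrite -big_mkcond /= -[RHS]big_filter; apply: perm_big; apply: uniq_perm.
      - exact: primes_uniq.
      - by rewrite filter_uniq ?primes_uniq.
      move=> p; rewrite mem_filter /=; have [pd|//] := boolP (p \in primes d).
      by rewrite (H p pd : p \in primes n).
    apply: dvdn_prod => p pn; case: ifP => // _.
    by rewrite -{1}[p]expn1 dvdn_exp2l // logn_gt0.
  by rewrite dn /= (leq_trans (dvdn_leq n0 dn)).
split=> //; apply/allP => p; rewrite /= !mem_primes n0 => /and3P[-> _ pd].
exact: dvdn_trans pd dn.
Qed.

(** Each squarefree d <= N occurs among the products of distinct primes <= N; the remaining terms of
    the expanded product are nonnegative. *)
Lemma sum_mprod_le_prod F N : (forall p, prime p -> 0 <= F p) ->
  \sum_(1 <= d < N.+1 | sqfree d) mprod F d <=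
  \prod_(1 <= p < N.+1 | prime p) (1 + F p).
Proof.
move=> F0; rewrite -[X in _ <= X]big_filter prod1D_sqdivs; first last.
- exact: filter_all.
- by rewrite filter_uniq // iota_uniq.
set ps := [seq p <- _ | prime p].
have ups : uniq ps by rewrite filter_uniq // iota_uniq.
have aps : all prime ps by exact: filter_all.
rewrite -big_filter; set s := [seq d <- index_iota 1 N.+1 | sqfree d].
have sub : {subset s <= sqdivs ps}.
  move=> d; rewrite mem_filter mem_index_iota => /and3P[sd d0 dN].
  rewrite mem_sqdivs // sd; apply/allP => p /=; rewrite mem_primes mem_filter.
  case/and3P=> -> _ pd; rewrite mem_index_iota /=.
  by rewrite (dvdn_gt0 d0 pd) ltnS (leq_trans (dvdn_leq d0 pd)).
rewrite [leRHS](bigID (mem s)) /=.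
have -> : \sum_(i <- sqdivs ps | i \in s) mprod F i = \sum_(d <- s) mprod F d.
  rewrite -big_filter; apply: perm_big; apply: uniq_perm.
  - by rewrite filter_uniq // sqdivs_uniq.
  - by rewrite filter_uniq // iota_uniq.
  move=> d; rewrite mem_filter /=; have [ds|//] := boolP (d \in s).
  by rewrite sub.
by rewrite lerDl sumr_ge0 // => d _; apply: mprod_ge0.
Qed.

Lemma sum_multiples (Phi : nat -> R) (N a : nat) : (0 < a)%N ->
  \sum_(1 <= d < N.+1 | (a %| d)%N) Phi d =
  \sum_(1 <= b < N.+1 | (a * b <= N)%N) Phi (a * b)%N.
Proof.
move=> a0; rewrite -big_filter -[RHS]big_filter -(big_map (muln a) xpredT Phi).
apply: perm_big; apply: uniq_perm.
- by rewrite filter_uniq // iota_uniq.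
- rewrite map_inj_uniq ?filter_uniq ?iota_uniq //.
  by move=> x y /eqP; rewrite eqn_pmul2l // => /eqP.
move=> d; rewrite mem_filter mem_index_iota; apply/andP/mapP.
  case=> /dvdnP[b ->] /andP[]; rewrite muln_gt0 => /andP[b0 _]; rewrite ltnS => h.
  exists b; last by rewrite mulnC.
  rewrite mem_filter mulnC h mem_index_iota b0 ltnS /=.
  by rewrite (leq_trans _ h) // leq_pmulr.
case=> b; rewrite mem_filter mem_index_iota => /and3P[h b0 _] ->.
by rewrite dvdn_mulr // muln_gt0 a0 b0 ltnS h.
Qed.

(** Expand the weight over the divisors a of d, exchange the sums and put d = a b. Letting d run
    over all integers only adds nonnegative terms. *)
Lemma sum_mprod1D_le F (Phi : nat -> R) N : (forall p, prime p -> 0 <= F p) ->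
  (forall d, 0 <= Phi d) ->
  \sum_(1 <= d < N.+1 | sqfree d) mprod (fun p => 1 + F p) d * Phi d <=
  \sum_(1 <= a < N.+1 | sqfree a) mprod F a *
    \sum_(1 <= b < N.+1 | (a * b <= N)%N) Phi (a * b)%N.
Proof.
move=> F0 P0.
have -> : \sum_(1 <= a < N.+1 | sqfree a) mprod F a *
    \sum_(1 <= b < N.+1 | (a * b <= N)%N) Phi (a * b)%N =
  \sum_(1 <= d < N.+1) mprod (fun p => 1 + F p) d * Phi d.
  transitivity (\sum_(1 <= a < N.+1 | sqfree a)
     \sum_(1 <= d < N.+1 | (a %| d)%N) mprod F a * Phi d).
    apply: eq_bigr => a sa.
    by rewrite -sum_multiples ?(sqfree_gt0 sa) // mulr_sumr.
  rewrite (exchange_big_dep_nat xpredT) //=.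
  apply: eq_big_nat => d; rewrite ltnS => dN.
  by rewrite (mprod1D _ dN) mulr_suml.
rewrite [X in X <= _]big_mkcond /=; apply: ler_sum => d _.
case: ifP => // _; rewrite mulr_ge0 // mprod_ge0 // => p pp.
by rewrite addr_ge0 // F0.
Qed.

End MultiplicativeFunctions.

(** * Sums of multiplicative weights *)

Section ElementarySums.
Variable R : realType.

Lemma sum_inv_sq_tail (y : R) N : 0 < y ->
  \sum_(1 <= b < N.+1 | y < b%:R) b%:R ^- 2 <= 2 / y.
Proof.
move=> y0; suff : \sum_(1 <= b < N.+1 | y < b%:R) b%:R ^- 2 <=
    if y < N%:R + 1 then 2 / y - 2 / (N%:R + 1) else 0.
  move/le_trans; apply; have := divr_ge0 (ler0n R 2) (ltW y0).
  case: ifP => _ // _; rewrite lerBlDr lerDl.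
  by rewrite divr_ge0 // addr_ge0.
elim: N => [|N IH].
  rewrite big_geq //; case: ifP => // y1; rewrite add0r in y1 *.
  by rewrite subr_ge0 ler_pM2l // lef_pV2 ?posrE // ltW.
rewrite big_mkcond big_nat_recr //= -big_mkcond /=.
have N0 : 0 < N%:R + 1 :> R by rewrite ltr_pwDr.
rewrite -natr1; case: (ltP y (N%:R + 1)) IH => [yN IH|yN IH].
  rewrite ifT; last by rewrite (lt_trans yN) // ltrDl.
  have : (N%:R + 1) ^- 2 <= 2 / (N%:R + 1) - 2 / (N%:R + 1 + 1) :> R.
    rewrite -subr_ge0.
    have -> : 2 / (N%:R + 1) - 2 / (N%:R + 1 + 1) - (N%:R + 1) ^- 2 =
      N%:R / ((N%:R + 1) ^+ 2 * (N%:R + 1 + 1)) :> R.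
      by field; rewrite !gt_eqF // addr_gt0.
    by rewrite divr_ge0 // mulr_ge0 ?sqr_ge0 ?addr_ge0.
  lra.
rewrite addr0; apply: le_trans IH _; case: ifP => // yN1.
have N1 : 0 < N%:R + 1 + 1 :> R by rewrite addr_gt0.
by rewrite subr_ge0 ler_pM2l // lef_pV2 // ltW.
Qed.

Lemma ln_step (n : nat) : (0 < n)%N -> n.+1%:R^-1 <= ln n.+1%:R - ln n%:R :> R.
Proof.
move=> n0; have nR : 0 < n%:R :> R by rewrite ltr0n.
have := @le_ln1Dx R (- n.+1%:R^-1).
rewrite ltrN2 invf_lt1 ?ltr0n // ltr1n ltnS n0 => /(_ isT).
have -> : 1 + - n.+1%:R^-1 = n%:R / n.+1%:R :> R.
  by rewrite -[n.+1%:R]natr1; field; rewrite natr1 pnatr_eq0.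
rewrite ln_div ?posrE // ?ltr0n // => h.
by rewrite -lerN2 opprB.
Qed.

Lemma sum_inv_le_ln N : (0 < N)%N ->
  \sum_(1 <= b < N.+1) b%:R^-1 <= 1 + ln N%:R :> R.
Proof.
elim: N => // -[|N] IH _; first by rewrite big_nat1 ln1 invr1 addr0.
rewrite big_nat_recr //=; apply: le_trans (lerD (IH isT) (@ln_step N.+1 isT)) _.
by rewrite -addrA subrKC.
Qed.

(** Each block of 30 consecutive integers has 8 members prime to 30. The initial block is bounded by
    8, and block j by 8 / (30 j). *)
Lemma sum_inv_coprime30_le N : (0 < N)%N ->
  \sum_(1 <= b < N.+1 | coprime b 30) b%:R^-1 <= 8 + 8 / 30 * (1 + ln N%:R) :> R.
Proof.
move=> N0.
have block J : \sum_(30 * J.+1 <= b < 30 * J.+2 | coprime b 30) b%:R^-1 <=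
   8 / 30 * J.+1%:R^-1 :> R.
  apply: (@le_trans _ _ (\sum_(30 * J.+1 <= b < 30 * J.+2 | coprime b 30)
      (30 * J.+1)%:R^-1)).
    rewrite big_nat_cond [leRHS]big_nat_cond.
    apply: ler_sum => b /andP[/andP[b1 _] _].
    have p30 : (0 < 30 * J.+1)%N by rewrite muln_gt0.
    by rewrite lef_pV2 ?posrE ?ltr0n ?ler_nat // (leq_trans p30).
  rewrite -{1}[(30 * J.+1)%N]add0n big_addn.
  have -> : (30 * J.+2 - 30 * J.+1 = 30)%N by rewrite -mulnBr subSnn muln1.
  under eq_bigl => i do rewrite coprime_sym /coprime addnC mulnC gcdnMDl.
  rewrite big_const_seq iter_addr_0; set k := count _ _.
  have -> : k = 8%N by rewrite /k; vm_compute.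
  by rewrite -[leLHS]mulr_natl natrM invfM mulrA.
have main J : \sum_(1 <= b < 30 * J.+1 | coprime b 30) b%:R^-1 <=
    8 + 8 / 30 * \sum_(1 <= j < J.+1) j%:R^-1 :> R.
  elim: J => [|J IH].
    rewrite [X in _ <= _ + _ * X]big_geq // mulr0 addr0 muln1.
    apply: (@le_trans _ _ (\sum_(1 <= b < 30 | coprime b 30) 1)).
      rewrite big_nat_cond [leRHS]big_nat_cond.
      apply: ler_sum => b /andP[/andP[b1 _] _].
      by rewrite invf_le1 ?ltr0n // ler1n.
    rewrite big_const_seq iter_addr_0; set k := count _ _.
    by have -> : k = 8%N by rewrite /k; vm_compute.
  rewrite (big_cat_nat _ (n := (30 * J.+1)%N)) //=; last first.
    by rewrite leq_pmul2l.
  rewrite [X in _ <= _ + _ * X]big_nat_recr //= mulrDr addrA.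
  exact: lerD IH (block J).
have N30 : (N.+1 <= 30 * N.+1)%N by rewrite leq_pmull.
apply: (@le_trans _ _ (\sum_(1 <= b < 30 * N.+1 | coprime b 30) b%:R^-1)).
  rewrite [leRHS](big_cat_nat _ (n := N.+1)) //= lerDl.
  by apply: sumr_ge0 => i _; rewrite invr_ge0.
apply: le_trans (main N) _; rewrite lerD2l.
by apply: ler_wpM2l; [lra | exact: sum_inv_le_ln].
Qed.

(* [hwt] and [dwt] both vanish at even [d], since [(2 - 2)^-1 = 0]. *)
Definition hwt (d : nat) : R := mprod (fun p => (p%:R - 2)^-1 : R) d.

Definition dwt (d : nat) : R :=
  if sqfree d then mprod (fun p => p%:R / (p%:R - 2) : R) d else 0.

Lemma primeB2_ge0 p : prime p -> 0 <= p%:R - 2 :> R.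
Proof. by move=> /prime_gt1 p1; rewrite subr_ge0 ler_nat. Qed.

Lemma hwt_ge0 d : 0 <= hwt d.
Proof. by apply: mprod_ge0 => p /primeB2_ge0; rewrite invr_ge0. Qed.

Lemma hwt_prime p : prime p -> hwt p = (p%:R - 2)^-1.
Proof. exact: mprod_prime. Qed.

Lemma hwt_mul a b : sqfree (a * b) -> hwt (a * b) = hwt a * hwt b.
Proof.
move=> s; have := sqfree_gt0 s; rewrite muln_gt0 => /andP[a0 b0].
by rewrite /hwt mprod_mul // sqfree_coprime.
Qed.

Lemma hwt_even d : (0 < d)%N -> ~~ odd d -> hwt d = 0.
Proof.
move=> d0 ed; apply/eqP; rewrite /hwt /mprod prodf_seq_eq0; apply/hasP.
exists 2%N; first by rewrite mem_primes d0 /= dvdn2.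
by rewrite subrr invr0 /=.
Qed.

Lemma dwtE d : sqfree d -> dwt d = d%:R * hwt d.
Proof.
by move=> sd; rewrite /dwt sd -(mprod_id R sd) mprodM.
Qed.

Lemma dwt_ge0 d : 0 <= dwt d.
Proof.
have [sd|nsd] := boolP (sqfree d); first by rewrite dwtE // mulr_ge0 ?hwt_ge0.
by rewrite /dwt (negbTE nsd).
Qed.

Lemma dwt_mul_le a b : (0 < a)%N -> (0 < b)%N -> dwt (a * b) <= dwt a * dwt b.
Proof.
move=> a0 b0; have [s|ns] := boolP (sqfree (a * b)); last first.
  by rewrite {1}/dwt (negbTE ns) mulr_ge0 ?dwt_ge0.
have sa := sqfree_mull s; have sb : sqfree b by move: s; rewrite mulnC => /sqfree_mull.
by rewrite !dwtE // hwt_mul // natrM mulrACA.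
Qed.

Lemma dwt_ge1 d : dwt d != 0 -> 1 <= dwt d.
Proof.
rewrite /dwt; case: ifP => [sd|]; last by rewrite eqxx.
rewrite /mprod prodf_seq_neq0 => /allP H; rewrite big_seq.
elim/big_ind: _ => // [x y x1 y1|p pd]; first by rewrite mulr_ege1.
have := H p pd; rewrite mulf_eq0 invr_eq0 negb_or => /andP[_ p2].
have pp : prime p by move: pd; rewrite mem_primes => /andP[].
have pos : 0 < p%:R - 2 :> R by rewrite lt_neqAle eq_sym p2 primeB2_ge0.
by rewrite ler_pdivlMr // mul1r gerBl.
Qed.

(* [dwt d ^+ 2 = \sum_(a %| d) mprod dfac a] for odd squarefree [d]. *)
Definition dfac (p : nat) : R :=
  if (2 < p)%N then (p%:R / (p%:R - 2)) ^+ 2 - 1 else 0.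

Lemma dfac_ge0 p : 0 <= dfac p.
Proof.
rewrite /dfac; case: ifP => // p2; rewrite subr_ge0 exprn_ege1 //.
have pos : 0 < p%:R - 2 :> R by rewrite subr_gt0 ltr_nat.
by rewrite ler_pdivlMr // mul1r gerBl.
Qed.

Lemma dwt_sqr_le d : sqfree d -> dwt d ^+ 2 <= mprod (fun p => 1 + dfac p) d.
Proof.
move=> sd; rewrite /dwt sd expr2 mprodM /mprod big_seq [leRHS]big_seq.
apply: ler_prod => p; rewrite mem_primes => /andP[pp _].
rewrite -expr2 sqr_ge0 /= /dfac; case: ltnP => p2; first by rewrite subrKC.
have -> : p = 2%N by apply/eqP; rewrite eqn_leq p2 prime_gt1.
by rewrite subrr invr0 mulr0 expr0n addr0.
Qed.

Lemma prod_dfac_le N :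
  \prod_(1 <= p < N.+1 | prime p) (1 + dfac p / p%:R) <= expR 8.
Proof.
apply: (@le_trans _ _ (\prod_(1 <= p < N.+1) expR (4 * (2 < p)%:R / (p%:R - 2) ^+ 2))).
  rewrite big_mkcond /=; apply: ler_prod => p _.
  have h0 : 0 <= 4 * (2 < p)%N%:R / (p%:R - 2) ^+ 2 :> R.
    by rewrite mulr_ge0 ?invr_ge0 ?sqr_ge0 // mulr_ge0.
  case: ifP => [pp|_]; last by rewrite ler01 -[leLHS]expR0 ler_expR.
  rewrite addr_ge0 ?divr_ge0 ?dfac_ge0 //=.
  apply: le_trans (expR_ge1Dx _); rewrite lerD2l /dfac.
  case: ifP => p2; last by rewrite mul0r mulr0 mul0r.
  have pos : 0 < p%:R - 2 :> R by rewrite subr_gt0 ltr_nat.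
  have p0 : 0 < p%:R :> R by rewrite ltr0n prime_gt0.
  rewrite -subr_ge0.
  have -> : 4 * 1 / (p%:R - 2) ^+ 2 - ((p%:R / (p%:R - 2)) ^+ 2 - 1) / p%:R =
     4 / (p%:R * (p%:R - 2) ^+ 2) :> R.
    by field; rewrite !gt_eqF.
  by rewrite divr_ge0 // mulr_ge0 ?sqr_ge0 // ltW.
rewrite -expR_sum ler_expR.
(* Telescopes through [4 / (n - 1)^2 <= 8 / (n - 1) - 8 / n] for n >= 3. The constant 8 makes the
   bound an equality at N = 3, where the first nonzero term appears. *)
suff : \sum_(1 <= p < N.+1) 4 * (2 < p)%N%:R / (p%:R - 2) ^+ 2 <=
    8 - 8 / (N%:R - 1) * (2 < N)%N%:R + (4 - 4) * N%:R :> R.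
  move/le_trans; apply; rewrite subrr mul0r addr0 gerBl.
  case: ltnP => N2; last by rewrite mulr0.
  by rewrite mulr1 divr_ge0 // subr_ge0 ler1n (leq_trans _ N2).
rewrite subrr mul0r addr0.
elim: N => [|N IH]; first by rewrite big_geq // mulr0 subr0.
rewrite big_nat_recr //=.
have [N3|] := ltnP 2 N; last first.
  case: N IH => [|[|[|//]]] IH _.
  - by apply: le_trans (lerD IH (lexx _)) _; rewrite !mulr0 mul0r subr0 addr0.
  - by apply: le_trans (lerD IH (lexx _)) _; rewrite !mulr0 mul0r subr0 addr0.
  rewrite big_nat_recr //= big_nat1 !mulr0 !mul0r !add0r mulr1.
  have -> : 3%:R - 2 = 1 :> R by ring.
  have -> : 3%:R - 1 = 2 :> R by ring.
  rewrite expr1n invr1. lra.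
apply: le_trans (lerD IH (lexx _)) _; rewrite N3 (ltn_trans N3) //=.
rewrite !mulr1 -[N.+1%:R]natr1.
have n3 : 3 <= N%:R :> R by rewrite ler_nat.
set n : R := N%:R in n3 *; rewrite -subr_ge0.
have -> : 8 - 8 / (n + 1 - 1) - (8 - 8 / (n - 1) + 4 / (n + 1 - 2) ^+ 2) =
   4 * (n - 2) / (n * (n - 1) ^+ 2).
  by field; rewrite !gt_eqF //; lra.
rewrite divr_ge0 // ?mulr_ge0 ?sqr_ge0 //; lra.
Qed.

(** If the multiples of a carry at most the share Y / a, then a enters the divisor expansion with
    weight F(a) / a, and an Euler product bounds the total. *)
Lemma sum_mprod1D_le_prod (F Phi : nat -> R) (Y : R) N :
  (forall p, prime p -> 0 <= F p) -> (forall d, 0 <= Phi d) -> 0 <= Y ->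
  (forall a, (0 < a)%N ->
     \sum_(1 <= b < N.+1 | (a * b <= N)%N) Phi (a * b)%N <= Y / a%:R) ->
  \sum_(1 <= d < N.+1 | sqfree d) mprod (fun p => 1 + F p) d * Phi d <=
  \prod_(1 <= p < N.+1 | prime p) (1 + F p / p%:R) * Y.
Proof.
move=> F0 P0 Y0 H; apply: le_trans (sum_mprod1D_le N F0 P0) _.
apply: (@le_trans _ _ (\sum_(1 <= a < N.+1 | sqfree a)
    mprod (fun p => F p / p%:R) a * Y)).
  apply: ler_sum => a sa.
  rewrite (_ : mprod _ a * Y = mprod F a * (Y / a%:R)); last first.
    have -> : a%:R^-1 = mprod (fun p => p%:R^-1 : R) a.
      by rewrite -{1}(mprod_id R sa) /mprod prodfV.
    by rewrite mulrCA mprodM mulrC.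
  by rewrite ler_wpM2l ?H ?(sqfree_gt0 sa) // mprod_ge0.
rewrite -mulr_suml ler_wpM2r //; apply: sum_mprod_le_prod => p pp.
by rewrite divr_ge0 ?F0.
Qed.

(** [dwt] is bounded in mean square, because the Euler product of [1 + dfac p / p] converges.
    Different [Phi] give all the averages of [dwt] below; first powers are covered by [dwt_le_sqr],
    the nonzero values being at least 1. *)
Lemma sum_dwt_sqr_le (Phi : nat -> R) (Y : R) N :
  (forall d, 0 <= Phi d) -> 0 <= Y ->
  (forall a, (0 < a)%N ->
     \sum_(1 <= b < N.+1 | (a * b <= N)%N) Phi (a * b)%N <= Y / a%:R) ->
  \sum_(1 <= d < N.+1) dwt d ^+ 2 * Phi d <= expR 8 * Y.
Proof.
move=> P0 Y0 H.
apply: (@le_trans _ _ (\sum_(1 <= d < N.+1 | sqfree d)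
    mprod (fun p => 1 + dfac p) d * Phi d)).
  rewrite [leRHS]big_mkcond /=; apply: ler_sum => d _; case: ifP => sd.
    by rewrite ler_wpM2r // dwt_sqr_le.
  by rewrite /dwt sd expr0n mul0r.
apply: le_trans (sum_mprod1D_le_prod (fun p _ => dfac_ge0 p) P0 Y0 H) _.
by rewrite ler_wpM2r // prod_dfac_le.
Qed.

Lemma dwt_le_sqr d : dwt d <= dwt d ^+ 2.
Proof.
have [->|d0] := eqVneq (dwt d) 0; first by rewrite expr0n.
by rewrite expr2 ler_peMr ?dwt_ge0 ?dwt_ge1.
Qed.

Lemma sum1_le (y : R) N : 0 <= y ->
  \sum_(1 <= b < N.+1 | b%:R <= y) 1 <= y.
Proof.
move=> y0; suff : \sum_(1 <= b < N.+1 | b%:R <= y) 1 <= y /\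
    \sum_(1 <= b < N.+1 | b%:R <= y) 1 <= N%:R :> R by case.
elim: N => [|N [IH1 IH2]]; first by rewrite big_geq.
rewrite big_mkcond big_nat_recr //= -big_mkcond /=; case: ifP => h.
  have : \sum_(1 <= i < N.+1 | i%:R <= y) 1 + 1 <= N.+1%:R :> R.
    by rewrite -natr1 lerD2r.
  by move=> h2; split => //; exact: le_trans h2 h.
by rewrite addr0; split => //; rewrite (le_trans IH2) // ler_nat.
Qed.

Lemma sum_multiples1_le (N m : nat) : (0 < m)%N ->
  \sum_(1 <= k < N.+1 | (m %| k)%N) 1 <= N%:R / m%:R :> R.
Proof.
move=> m0; rewrite sum_multiples //.
have m1 : 0 < m%:R :> R by rewrite ltr0n.
have := @sum1_le (N%:R / m%:R) N; rewrite divr_ge0 // => /(_ isT).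
by under eq_bigl => b do rewrite ler_pdivlMr // -natrM mulnC ler_nat.
Qed.

Lemma sum_dwt_tail_le (x : R) N : 0 < x ->
  \sum_(1 <= d < N.+1 | x < d%:R) dwt d / d%:R ^+ 2 <= expR 8 * (2 / x).
Proof.
move=> x0; pose Phi (d : nat) : R := if x < d%:R then d%:R ^- 2 else 0.
have P0 d : 0 <= Phi d by rewrite /Phi; case: ifP => // _; rewrite invr_ge0 sqr_ge0.
apply: le_trans (sum_dwt_sqr_le P0 _ _); first last.
- move=> a a0; have aR : 0 < a%:R :> R by rewrite ltr0n.
  have xa : 0 < x / a%:R by rewrite divr_gt0.
  apply: (@le_trans _ _ (\sum_(1 <= b < N.+1 | x / a%:R < b%:R) a%:R ^- 2 * b%:R ^- 2)).
    rewrite big_mkcond [leRHS]big_mkcond; apply: ler_sum => b _ /=.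
    rewrite ltr_pdivrMr // -natrM mulnC -invfM -exprMn -natrM /Phi.
    by case: ifP => _; case: ifP => // _; rewrite ?[(b * a)%N]mulnC ?invr_ge0 ?sqr_ge0.
  rewrite -mulr_sumr; apply: le_trans (ler_wpM2l _ (sum_inv_sq_tail N xa)) _.
    by rewrite invr_ge0 sqr_ge0.
  rewrite le_eqVlt; apply/orP; left; apply/eqP; field.
  by rewrite !gt_eqF.
- by rewrite divr_ge0 // ltW.
rewrite big_mkcond; apply: ler_sum => d _; rewrite /Phi; case: ifP => _.
  by rewrite ler_wpM2r ?dwt_le_sqr // invr_ge0 sqr_ge0.
by rewrite mulr0.
Qed.

Lemma sum_dwt_sqr_inv_le N : (0 < N)%N ->
  \sum_(1 <= d < N.+1) dwt d ^+ 2 / d%:R <= expR 8 * (1 + ln N%:R).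
Proof.
move=> N0; have lnN : 0 <= 1 + ln N%:R :> R by rewrite addr_ge0 // ln_ge0 // ler1n.
apply: sum_dwt_sqr_le => [d|//|a a0]; first by rewrite invr_ge0.
apply: (@le_trans _ _ (\sum_(1 <= b < N.+1) a%:R^-1 * b%:R^-1)).
  rewrite big_mkcond; apply: ler_sum => b _; rewrite natrM invfM.
  by case: ifP => // _; apply: mulr_ge0; rewrite invr_ge0.
by rewrite -mulr_sumr mulrC ler_wpM2r ?invr_ge0 // sum_inv_le_ln.
Qed.

Lemma sum_dwt_le (z : R) N : 0 <= z ->
  \sum_(1 <= d < N.+1 | d%:R <= z) dwt d <= expR 8 * z.
Proof.
move=> z0; pose Phi (d : nat) : R := if d%:R <= z then 1 else 0.
have P0 d : 0 <= Phi d by rewrite /Phi; case: ifP.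
apply: le_trans (sum_dwt_sqr_le P0 z0 _); last first.
  move=> a a0; have aR : 0 < a%:R :> R by rewrite ltr0n.
  apply: le_trans (sum1_le N (divr_ge0 z0 (ltW aR))).
  rewrite big_mkcond [leRHS]big_mkcond; apply: ler_sum => b _ /=.
  rewrite ler_pdivlMr // -natrM mulnC /Phi.
  by case: ifP => // _; case: ifP.
rewrite big_mkcond; apply: ler_sum => d _; rewrite /Phi; case: ifP => _.
  by rewrite mulr1 dwt_le_sqr.
by rewrite mulr0.
Qed.

End ElementarySums.

(** * The summatory function of [hwt] with an explicit leading constant *)

Section SharpSum.
Variable R : realType.
Local Notation hwt := (@hwt R).

(** Split according to whether q divides d. If it does, d = q b with b prime to m q, and [hwt]
    factors. *)
Lemma sum_hwt_coprime_mul (q m N : nat) : prime q ->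
  \sum_(1 <= d < N.+1 | sqfree d && coprime d m) hwt d <=
  (1 + hwt q) * \sum_(1 <= d < N.+1 | sqfree d && coprime d (m * q)) hwt d.
Proof.
move=> pq; have q0 := prime_gt0 pq.
rewrite (bigID (fun d => (q %| d)%N)) /= addrC mulrDl mul1r; apply: lerD.
  rewrite le_eqVlt; apply/orP; left; apply/eqP; apply: eq_bigl => d.
  by rewrite coprimeMr (coprime_sym d q) (prime_coprime _ pq) andbA.
pose Phi (d : nat) : R := if sqfree d && coprime d m then hwt d else 0.
have -> : \sum_(1 <= d < N.+1 | sqfree d && coprime d m && (q %| d)%N) hwt d =
    \sum_(1 <= d < N.+1 | (q %| d)%N) Phi d.
  rewrite big_mkcond [RHS]big_mkcond /=; apply: eq_bigr => d _; rewrite /Phi.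
  by case: (sqfree d && coprime d m); case: (q %| d)%N.
rewrite sum_multiples // mulr_sumr big_mkcond [leRHS]big_mkcond /=.
apply: ler_sum => b _; rewrite /Phi.
have h0 : 0 <= hwt q * hwt b by rewrite mulr_ge0 ?hwt_ge0.
case: ifP => _; last by case: ifP.
case: ifP => [/andP[sqb cqb]|_]; last by case: ifP.
have sb : sqfree b by move: sqb; rewrite mulnC => /sqfree_mull.
rewrite sb coprimeMr; move: cqb; rewrite coprimeMl => /andP[_ ->] /=.
by rewrite coprime_sym (sqfree_coprime sqb) hwt_mul.
Qed.

(** Here [1 + sfac p = p / (p - 2)] for p > 6, so on squarefree d prime to 30 the divisor sum of
    [sfac] is [d * hwt d]. *)
Definition sfac (p : nat) : R := if (6 < p)%N then 2 / (p%:R - 2) else 0.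

Lemma sfac_ge0 p : 0 <= sfac p.
Proof.
rewrite /sfac; case: ifP => // p6.
by rewrite divr_ge0 // subr_ge0 ler_nat (leq_trans _ p6).
Qed.

Lemma prod_sfac_le N :
  \prod_(1 <= p < N.+1 | prime p) (1 + sfac p / p%:R) <= 5 / 4.
Proof.
have f1 p : 1 <= 1 + sfac p / p%:R by rewrite lerDl divr_ge0 ?sfac_ge0.
have mono a b : (a <= b)%N ->
    \prod_(1 <= p < a.+1 | prime p) (1 + sfac p / p%:R) <=
    \prod_(1 <= p < b.+1 | prime p) (1 + sfac p / p%:R).
  elim: b => [|b IH]; first by rewrite leqn0 => /eqP ->.
  rewrite leq_eqVlt => /orP[/eqP-> //|]; rewrite ltnS => /IH /le_trans; apply.
  rewrite [leRHS]big_mkcond big_nat_recr //= -big_mkcond /=.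
  have P0 : 0 <= \prod_(1 <= p < b.+1 | prime p) (1 + sfac p / p%:R).
    by apply: prodr_ge0 => p _; rewrite (le_trans _ (f1 p)).
  by case: ifP => _; rewrite ?mulr1 // ler_peMr.
(* Only the oddness of the primes beyond 5 is used: for odd n the new factor is at most
   [1 + 2 / (n (n + 2))]. The constant 5/4 makes the start exact, as 5/4 (1 - 1/5) = 1 is the empty
   product. *)
have main m : \prod_(1 <= p < (2 * m + 5).+1 | prime p) (1 + sfac p / p%:R) <=
    5 / 4 * (1 - (2 * m + 5)%:R^-1).
  elim: m => [|m IH].
    rewrite muln0 add0n big_nat_cond big1 => [|p /andP[/andP[_ p6] _]].
      by lra.
    by rewrite /sfac ltnNge -ltnS ltnW // mul0r addr0.
  have -> : (2 * m.+1 + 5 = (2 * m + 5).+2)%N by rewrite mulnS.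
  set n := (2 * m + 5)%N in IH *.
  have n5 : (5 <= n)%N by rewrite leq_addl.
  have on : odd n by rewrite oddD oddM.
  rewrite big_mkcond 2?big_nat_recr //= -big_mkcond /=.
  have -> : prime n.+1 = false.
    apply/negP => /even_prime[n2|]; first by move: n5; rewrite -ltnS n2.
    by rewrite /= on.
  rewrite mulr1; apply: (@le_trans _ _ (5 / 4 * (1 - n%:R^-1) * (1 + sfac n.+2 / n.+2%:R))).
    apply: ler_pM => //; last by case: ifP.
      by apply: prodr_ge0 => p _; rewrite (le_trans _ (f1 p)).
    by case: ifP => // _; rewrite (le_trans _ (f1 _)).
  have n7 : (6 < n.+2)%N by rewrite !ltnS.
  rewrite /sfac n7.
  have nR : 5 <= n%:R :> R by rewrite ler_nat.
  have -> : n.+2%:R = n%:R + 2 :> R by rewrite -natrD addn2.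
  set x : R := n%:R in nR *; rewrite -subr_ge0.
  have -> : 5 / 4 * (1 - (x + 2)^-1) -
     5 / 4 * (1 - x^-1) * (1 + 2 / (x + 2 - 2) / (x + 2)) =
     5 / 2 / (x ^+ 2 * (x + 2)).
    by field; rewrite !gt_eqF //; lra.
  by rewrite divr_ge0 // mulr_ge0 ?sqr_ge0 //; lra.
apply: le_trans (mono N (2 * N + 5)%N _) _.
  by rewrite -[leqLHS]addn0 leq_add // leq_pmull.
apply: le_trans (main N) _; rewrite -[leRHS]mulr1 ler_pM2l; last by lra.
by rewrite gerBl invr_ge0.
Qed.

(** The factor 8/3 = (1 + 0)(1 + 1)(1 + 1/3) restores the primes 2, 3, 5; 5/4 bounds the remaining
    Euler product and 8/30 is the density of the integers prime to 30. The coefficient of [ln N] is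
    thus 8/9, and multiplication by 2 (45/64) in [sum_swt_le] turns it into 5/4. *)
Lemma sum_hwt_le N : (0 < N)%N ->
  \sum_(1 <= d < N.+1 | sqfree d) hwt d <=
  8 / 3 * (5 / 4 * (8 + 8 / 30 * (1 + ln N%:R))).
Proof.
move=> N0; set Y : R := 8 + _.
have Y0 : 0 <= Y.
  by have := @ln_ge0 R N%:R; rewrite ler1n N0 => /(_ isT) => l0; rewrite /Y; lra.
have S30 : \sum_(1 <= d < N.+1 | sqfree d && coprime d 30) hwt d <= 5 / 4 * Y.
  pose Phi (d : nat) : R := if coprime d 30 then d%:R^-1 else 0.
  have P0 d : 0 <= Phi d by rewrite /Phi; case: ifP => // _; rewrite invr_ge0.
  apply: le_trans (ler_wpM2r Y0 (prod_sfac_le N)).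
  apply: le_trans (sum_mprod1D_le_prod (fun p _ => sfac_ge0 p) P0 Y0 _); last first.
    move=> a a0; apply: (@le_trans _ _
        (\sum_(1 <= b < N.+1 | coprime b 30) a%:R^-1 * b%:R^-1)).
      rewrite big_mkcond [leRHS]big_mkcond; apply: ler_sum => b _ /=.
      rewrite /Phi coprimeMl natrM invfM.
      have h0 : 0 <= a%:R^-1 * b%:R^-1 :> R by rewrite mulr_ge0 ?invr_ge0.
      by case: ifP => _; case: (coprime b 30); rewrite ?andbT ?andbF //; case: ifP.
    rewrite -mulr_sumr mulrC ler_wpM2r ?invr_ge0 //.
    exact: sum_inv_coprime30_le.
  rewrite big_mkcond [leRHS]big_mkcond; apply: ler_sum => d _ /=.
  case: ifP => [/andP[sd cd]|]; last first.
    case: ifP => // _ _; rewrite mulr_ge0 // mprod_ge0 // => p _.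
    by rewrite addr_ge0 // sfac_ge0.
  rewrite sd /Phi cd ler_pdivlMr ?ltr0n ?(sqfree_gt0 sd) //.
  rewrite mulrC -dwtE // /dwt sd /mprod le_eqVlt; apply/orP; left; apply/eqP.
  apply: eq_mprod => p pp pd; rewrite /sfac.
  have cp : coprime p 30 by apply: coprime_dvdl pd cd.
  have p6 : (6 < p)%N.
    rewrite ltnNge; apply/negP => p6.
    have /allP/(_ p) : all (fun p => ~~ (prime p && coprime p 30)) (iota 0 7) by vm_compute.
    by rewrite mem_iota ltnS p6 pp cp => /(_ isT).
  have p2 : 0 < p%:R - 2 :> R by rewrite subr_gt0 ltr_nat (leq_trans _ p6).
  by rewrite p6; field; rewrite gt_eqF.
have h : hwt 2 = 0 /\ hwt 3 = 1 /\ hwt 5 = 1 / 3.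
  split; last split; rewrite hwt_prime //; first by rewrite subrr invr0.
    by rewrite (_ : 3%:R - 2 = 1) ?invr1 //; ring.
  by rewrite (_ : 5%:R - 2 = 3) ?div1r //; ring.
have [h2 [h3 h5]] := h.
have s1 : \sum_(1 <= d < N.+1 | sqfree d) hwt d =
    \sum_(1 <= d < N.+1 | sqfree d && coprime d 1) hwt d.
  by apply: eq_bigl => d; rewrite coprimen1 andbT.
have := @sum_hwt_coprime_mul 3 1 N isT; have := @sum_hwt_coprime_mul 5 3 N isT.
have := @sum_hwt_coprime_mul 2 15 N isT.
rewrite -s1 h2 h3 h5 mul1n (_ : 3 * 5 = 15)%N // (_ : 15 * 2 = 30)%N //.
by lra.
Qed.

End SharpSum.

(** * The singular series as a divisor sum *)

Section SingularSeries.
Variable R : realType.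

(** 45/64 = (1 - 1/4)(1 - 1/16) is the partial product over p = 3, 5, and the partial products do
    not increase. *)
Lemma twin_const_bounds : 0 <= twin_const R <= 45 / 64.
Proof.
pose u (n : nat) : R := \prod_(3 <= p < n | prime p) (1 - 1 / (p%:R - 1) ^+ 2).
have f01 (p : nat) : (3 <= p)%N ->
    0 <= 1 - 1 / (p%:R - 1) ^+ 2 :> R /\ 1 - 1 / (p%:R - 1) ^+ 2 <= 1 :> R.
  move=> p3; have p2 : 2 <= p%:R - 1 :> R.
    by move: p3; rewrite -(ler_nat R); lra.
  have sq : 1 <= (p%:R - 1) ^+ 2 :> R by rewrite exprn_ege1 //; lra.
  have sq0 : 0 < (p%:R - 1) ^+ 2 :> R by lra.
  have i0 : 0 <= 1 / (p%:R - 1) ^+ 2 :> R by rewrite divr_ge0 // ltW.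
  have i1 : 1 / (p%:R - 1) ^+ 2 <= 1 :> R by rewrite ler_pdivrMr // mul1r.
  by rewrite subr_ge0 gerBl.
have u0 n : 0 <= u n.
  rewrite /u big_nat_cond; apply: prodr_ge0 => p /andP[/andP[p3 _] _].
  by have [] := f01 p p3.
have udec : nonincreasing_seq u.
  apply/nonincreasing_seqP => n; rewrite /u.
  have [n3|n3] := leqP 3 n; last by rewrite !big_geq // ltnW.
  rewrite big_mkcond big_nat_recr //= -big_mkcond /= -/(u n).
  case: ifP => _; last by rewrite mulr1.
  by have [_ h] := f01 n n3; rewrite ler_piMr.
have ucvg : cvgn u.
  by apply: nonincreasing_is_cvgn => //; exists 0 => _ [n _ <-].
apply/andP; split; first by apply: limr_ge => //; exact: nearW.
have u6 : u 6%N = 45 / 64.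
  rewrite /u big_mkcond 3?big_nat_recl // big_geq //= mulr1 mul1r.
  have -> : 3%:R - 1 = 2 :> R by ring.
  have -> : 5%:R - 1 = 4 :> R by ring.
  by field.
by rewrite -u6; exact: nonincreasing_cvgn_ge.
Qed.

(** The coefficients u(d) of the singular series; they vanish at even d together with [hwt]. *)
Definition swt (d : nat) : R :=
  if sqfree d then 2 * twin_const R * hwt R d else 0.

Lemma swt_ge0 d : 0 <= swt d.
Proof.
rewrite /swt; case: ifP => // _; have /andP[c0 _] := twin_const_bounds.
by rewrite !mulr_ge0 // hwt_ge0.
Qed.

Lemma swt_le_dwt d : (0 < d)%N -> swt d <= 3 / 2 * (dwt R d / d%:R).
Proof.
move=> d0; have dR : 0 < d%:R :> R by rewrite ltr0n.
rewrite /swt; case: ifP => sd; last by rewrite /dwt sd mul0r mulr0.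
rewrite dwtE // [_ / d%:R]mulrAC divff ?gt_eqF // mul1r ler_wpM2r ?hwt_ge0 //.
by have /andP[_ c1] := twin_const_bounds; lra.
Qed.

(** The local factor at p > 2 is 1 + 1 / (p - 2), and the convention 1 / 0 = 0 gives the factor 1 at
    p = 2. For k even and d odd, d | k amounts to 2 d | k. *)
Lemma singular_seriesE (k N : nat) : (0 < k <= N)%N ->
  singular_series R k%:Z = \sum_(1 <= d < N.+1 | (2 * d %| k)%N) swt d.
Proof.
case/andP=> k0 kN; rewrite /singular_series absz_nat.
case: ifP => k2; last first.
  rewrite big1 // => d h; move: k2.
  by rewrite (dvdn_trans _ h) // dvdn_mulr.
rewrite big_mkcond /=.
have -> : \prod_(p <- primes k)
    (if (2 < p)%N then (p%:R - 1) / (p%:R - 2) else 1 : R) =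
    mprod (fun p => 1 + (p%:R - 2)^-1 : R) k.
  apply: eq_big_seq => p; rewrite mem_primes => /and3P[pp _ _].
  have [p2|p2] := ltnP 2 p.
    have h : 0 < p%:R - 2 :> R by rewrite subr_gt0 ltr_nat.
    by field; rewrite gt_eqF.
  have -> : p = 2%N by apply/eqP; rewrite eqn_leq p2 prime_gt1.
  by rewrite subrr invr0 addr0.
rewrite (@mprod1D _ _ N) ?k0 // mulr_sumr big_mkcond [RHS]big_mkcond /=.
apply: eq_big_nat => d /andP[d0 _]; rewrite /swt.
have [od|ed] := boolP (odd d).
  rewrite Gauss_dvd ?coprime2n // k2 /=.
  by case: (sqfree d); case: (d %| k)%N.
rewrite -/(hwt R d) hwt_even // !mulr0.
by case: (sqfree d); case: (d %| k)%N; case: (2 * d %| k)%N.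
Qed.

Lemma sum_swt_le N : (0 < N)%N ->
  \sum_(1 <= d < N.+1) swt d <= 5 / 4 * ln N%:R + 40.
Proof.
move=> N0; have /andP[c0 c1] := twin_const_bounds.
have l0 : 0 <= ln N%:R :> R by rewrite ln_ge0 // ler1n.
have S0 : 0 <= \sum_(1 <= d < N.+1 | sqfree d) hwt R d.
  by apply: sumr_ge0 => d _; exact: hwt_ge0.
rewrite /swt -big_mkcond -mulr_sumr.
apply: (@le_trans _ _ (2 * (45 / 64) * \sum_(1 <= d < N.+1 | sqfree d) hwt R d)).
  by rewrite ler_wpM2r // ler_wpM2l.
have := sum_hwt_le R N0; lra.
Qed.

End SingularSeries.

(** * Trigonometric sums *)

Section TrigonometricSums.
Variable R : realType.
Implicit Types (x a th : R) (f : R -> R).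

Lemma sqr_trig_sum (s : seq nat) (P : pred nat) (c : nat -> R) th :
  (\sum_(n <- s | P n) c n * cos (n%:R * th)) ^+ 2 +
  (\sum_(n <- s | P n) c n * sin (n%:R * th)) ^+ 2 =
  \sum_(n <- s | P n) \sum_(n' <- s | P n')
    c n * c n' * cos ((n%:R - n'%:R) * th).
Proof.
rewrite !expr2 !big_distrlr -big_split; apply: eq_bigr => n _ /=.
rewrite -big_split; apply: eq_bigr => n' _ /=.
by rewrite mulrBl cosB; ring.
Qed.

Lemma sin_cos_progression a x J :
  2 * sin x * \sum_(0 <= j < J) cos (a + 2 * j%:R * x) =
  sin (a + (2 * J%:R - 1) * x) - sin (a - x).
Proof.
elim: J => [|J IH]; first by rewrite big_geq // !mulr0 sub0r mulN1r subrr.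
rewrite big_nat_recr //= mulrDr IH -[J.+1%:R]natr1.
have -> : a + (2 * (J%:R + 1) - 1) * x = a + 2 * J%:R * x + x by ring.
have -> : a + (2 * J%:R - 1) * x = a + 2 * J%:R * x - x by ring.
set y := a + 2 * J%:R * x; rewrite (sinD y x) (sinB y x); ring.
Qed.

Lemma sin_sin_progression a x J :
  2 * sin x * \sum_(0 <= j < J) sin (a + 2 * j%:R * x) =
  cos (a - x) - cos (a + (2 * J%:R - 1) * x).
Proof.
elim: J => [|J IH]; first by rewrite big_geq // !mulr0 sub0r mulN1r subrr.
rewrite big_nat_recr //= mulrDr IH -[J.+1%:R]natr1.
have -> : a + (2 * (J%:R + 1) - 1) * x = a + 2 * J%:R * x + x by ring.
have -> : a + (2 * J%:R - 1) * x = a + 2 * J%:R * x - x by ring.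
set y := a + 2 * J%:R * x; rewrite (cosD y x) (cosB y x); ring.
Qed.

Lemma sqr_sin_half x : sin x ^+ 2 = (1 - cos (2 * x)) / 2.
Proof. by rewrite mulr_natl cos_mulr2n sin2cos2 -[_ *+ 2]mulr_natl; field. Qed.

(** Multiplied by 2 sin x, both sums telescope to differences of sines and cosines at two angles;
    the squares then add up to a squared chord of the unit circle. *)
Lemma sqr_progression a x J :
  sin x ^+ 2 * ((\sum_(0 <= j < J) cos (a + 2 * j%:R * x)) ^+ 2 +
                (\sum_(0 <= j < J) sin (a + 2 * j%:R * x)) ^+ 2) =
  sin (J%:R * x) ^+ 2.
Proof.
have -> : forall s C S : R, s ^+ 2 * (C ^+ 2 + S ^+ 2) =
    ((2 * s * C) ^+ 2 + (2 * s * S) ^+ 2) / 4 by move=> s C S; field.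
have chord (A B : R) : ((sin A - sin B) ^+ 2 + (cos B - cos A) ^+ 2) / 4 =
    sin ((A - B) / 2) ^+ 2.
  rewrite sqr_sin_half (_ : 2 * ((A - B) / 2) = A - B); last by field.
  rewrite cosB; have := cos2Dsin2 A; have := cos2Dsin2 B.
  set cA := cos A; set sA := sin A; set cB := cos B; set sB := sin B => hB hA.
  have -> : (sA - sB) ^+ 2 + (cB - cA) ^+ 2 =
     (cA ^+ 2 + sA ^+ 2) + (cB ^+ 2 + sB ^+ 2) - 2 * (cA * cB + sA * sB) by ring.
  by rewrite hA hB; field.
rewrite sin_cos_progression sin_sin_progression chord.
by congr (sin _ ^+ 2); field.
Qed.

Definition grid_mean (M : nat) (f : R -> R) : R :=
  M%:R^-1 * \sum_(0 <= j < M) f (2 * pi * (j%:R / M%:R)).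

Lemma grid_mean_cos (M k : nat) : (0 < k < M)%N ->
  grid_mean M (fun th => cos (k%:R * th)) = 0.
Proof.
case/andP=> k0 kM; have M0 : (0 < M)%N by apply: leq_trans kM.
have MR : 0 < M%:R :> R by rewrite ltr0n.
have kR : 0 < k%:R :> R by rewrite ltr0n.
pose x : R := k%:R * pi / M%:R.
have sx : 0 < sin x.
  apply: sin_gt0_pi; rewrite /x divr_gt0 ?mulr_gt0 ?pi_gt0 //=.
  by rewrite ltr_pdivrMr // mulrC ltr_pM2l ?pi_gt0 // ltr_nat.
suff h : \sum_(0 <= j < M) cos (0 + 2 * j%:R * x) = 0.
  rewrite /grid_mean (_ : \sum_(0 <= j < M) _ = 0) ?mulr0 // -[RHS]h.
  by apply: eq_bigr => j _; congr cos; rewrite /x; field; rewrite gt_eqF.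
have := sin_cos_progression 0 x M.
have -> : 0 + (2 * M%:R - 1) * x = 0 - x + pi *+ 2 *+ k.
  rewrite -[pi *+ 2]mulr_natl -[_ *+ k]mulr_natl /x; field.
  by rewrite gt_eqF.
rewrite (periodicn (@sinD2pi R)) subrr => /eqP.
by rewrite !mulf_eq0 pnatr_eq0 (gt_eqF sx) /= => /eqP.
Qed.

(** The kernel G_m. Starting at 0 instead of 1 changes nothing, since only the differences n - n'
    matter. *)
Definition modker (m N : nat) th : R :=
  \sum_(0 <= n < N) \sum_(0 <= n' < N | (n == n' %[mod m])%N)
    cos ((n%:R - n'%:R) * th).

Lemma sum_diff (phi : nat -> R) N :
  \sum_(0 <= n < N) \sum_(0 <= n' < N) phi `|n - n'|%N =
  N%:R * phi 0%N + 2 * \sum_(1 <= k < N) (N - k)%:R * phi k.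
Proof.
elim: N => [|N IH]; first by rewrite !big_geq // mul0r mulr0 addr0.
have rev : \sum_(0 <= n < N) phi `|N - n|%N = \sum_(1 <= k < N.+1) phi k.
  rewrite big_add1 big_nat_rev /= add0n; apply: eq_big_nat => n /andP[_ nN].
  by congr phi; lia.
rewrite big_nat_recr //=; under eq_bigr => n _ do rewrite big_nat_recr //=.
rewrite big_split /= IH big_nat_recr //= distnn rev.
under [X in _ + X + _ = _]eq_bigr => n _ do rewrite distnC.
rewrite rev.
have -> : \sum_(1 <= k < N.+1) (N.+1 - k)%:R * phi k =
   \sum_(1 <= k < N) (N - k)%:R * phi k + \sum_(1 <= k < N.+1) phi k.
  case: N {IH rev} => [|N]; first by rewrite !big_geq // addr0.
  rewrite big_nat_recr //= [in X in _ = _ + X]big_nat_recr //= subSnn mul1r addrA.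
  rewrite -big_split /=; congr (_ + _); apply: eq_big_nat => k /andP[_ kN].
  by rewrite subSn ?(ltnW kN) // -natr1 mulrDl mul1r.
by rewrite -natr1; ring.
Qed.

Lemma modker_fourier m N th : (0 < m)%N ->
  modker m N th = N%:R +
    2 * \sum_(1 <= k < N | (m %| k)%N) (N - k)%:R * cos (k%:R * th).
Proof.
move=> m0; pose phi k : R := if (m %| k)%N then cos (k%:R * th) else 0.
have := sum_diff phi N; rewrite {2}/phi dvdn0 mul0r cos0 mulr1.
rewrite [X in _ = _ + _ * X](_ : _ =
   \sum_(1 <= k < N | (m %| k)%N) (N - k)%:R * cos (k%:R * th)); last first.
  rewrite [RHS]big_mkcond; apply: eq_bigr => k _; rewrite /phi.
  by case: ifP; rewrite ?mulr0.
move=> <-; apply: eq_bigr => n _; rewrite [LHS]big_mkcond /=.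
apply: eq_bigr => n' _; rewrite /phi.
wlog nn' : n n' / (n' <= n)%N => [H|].
  have [|/ltnW h] := leqP n' n; first exact: H.
  have -> : cos ((n%:R - n'%:R) * th) = cos ((n'%:R - n%:R) * th).
    by rewrite -cosN -mulNr opprB.
  by rewrite eq_sym distnC; exact: H.
by rewrite distnEl // eqn_mod_dvd // natrB.
Qed.

Lemma modker_classes m N th : (0 < m)%N ->
  modker m N th = \sum_(0 <= r < m)
    ((\sum_(0 <= n < N | (n %% m == r)%N) cos (n%:R * th)) ^+ 2 +
     (\sum_(0 <= n < N | (n %% m == r)%N) sin (n%:R * th)) ^+ 2).
Proof.
move=> m0; transitivity (\sum_(0 <= r < m) \sum_(0 <= n < N | (n %% m == r)%N)
    \sum_(0 <= n' < N | (n' %% m == r)%N) cos ((n%:R - n'%:R) * th)); last first.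
  apply: eq_bigr => r _; have := sqr_trig_sum (index_iota 0 N)
    (fun n => n %% m == r)%N (fun=> 1) th.
  under [X in X ^+ 2 + _ = _]eq_bigr => n _ do rewrite mul1r.
  under [X in _ + X ^+ 2 = _]eq_bigr => n _ do rewrite mul1r.
  move=> ->; apply: eq_bigr => n _; apply: eq_bigr => n' _.
  by rewrite !mul1r.
rewrite (exchange_big_dep_nat xpredT) //=; apply: eq_bigr => n _.
rewrite [RHS]big_mkcond /=.
rewrite [RHS](bigD1_seq (n %% m)%N) ?iota_uniq //=; last first.
  by rewrite mem_index_iota ltn_mod.
rewrite eqxx [X in _ = _ + X]big1 => [|r rn]; last first.
  by rewrite eq_sym (negbTE rn).
rewrite addr0.
by apply: eq_bigl => n'; rewrite eq_sym.
Qed.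

Lemma modker_ge0 m N th : (0 < m)%N -> 0 <= modker m N th.
Proof.
move=> m0; rewrite modker_classes //; apply: sumr_ge0 => r _.
by rewrite addr_ge0 ?sqr_ge0.
Qed.

(** A single J serves every f, so the cosine and sine sums over a class run over the same
    progression. *)
Lemma sum_residue_class (m r N : nat) : (r < m)%N -> exists J,
  forall f : nat -> R, \sum_(0 <= n < N | (n %% m == r)%N) f n =
    \sum_(0 <= j < J) f (r + j * m)%N.
Proof.
move=> rm; have m0 : (0 < m)%N by apply: leq_ltn_trans rm.
(* This is (N - r) / m rounded up, in a form that also gives 0 when N <= r. *)
exists ((N + (m - r.+1)) %/ m)%N => f.
elim: N => [|N IH].
  rewrite add0n divn_small ?big_geq //.
  by rewrite -[X in (_ < X)%N](subnK rm) addnS ltnS leq_addr.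
rewrite big_mkcond big_nat_recr //= -big_mkcond /= IH addSn.
case: eqP => [Nr|Nr].
  have e1 : ((N + (m - r.+1)) %/ m = N %/ m)%N.
    rewrite {1}(divn_eq N m) Nr -addnA (_ : r + (m - r.+1) = m.-1)%N; last by lia.
    by rewrite divnMDl // (@divn_small m.-1) ?addn0 ?ltn_predL.
  have e2 : ((N + (m - r.+1)).+1 %/ m = (N %/ m).+1)%N.
    rewrite {1}(divn_eq N m) Nr -addnA -addnS (_ : (r + (m - r.+1)).+1 = m)%N; last by lia.
    by rewrite divnMDl // divnn m0 addn1.
  rewrite e1 e2 big_nat_recr //=; congr (_ + f _).
  by rewrite {1}(divn_eq N m) Nr addnC.
rewrite addr0; congr (\sum_(0 <= j < _) _).
have := ltn_pmod N m0; move: Nr.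
have := divn_eq N m; set q := (N %/ m)%N; set t := (N %% m)%N => -> tr tm.
rewrite -!addnA -!addnS !divnMDl //; congr (_ + _)%N.
have [tlr|rlt|/tr//] := ltngtP t r.
  by rewrite !divn_small //; lia.
have -> : (t + (m - r.+1) = m + (t - r.+1))%N by lia.
have -> : (t + (m - r.+1).+1 = m + (t - r))%N by lia.
by rewrite !divnDl // !(@divn_small (t - _)%N) //; lia.
Qed.

(** On each of the m residue classes the exponential sum is geometric with step m, and its squared
    modulus times sin^2(m th / 2) is a squared sine, hence at most 1. *)
Lemma sqr_sin_modker m N th : (0 < m)%N ->
  sin (m%:R * th / 2) ^+ 2 * modker m N th <= m%:R.
Proof.
move=> m0; rewrite modker_classes // mulr_sumr.
apply: (@le_trans _ _ (\sum_(0 <= r < m) 1)); last first.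
  by rewrite sumr_const_nat subn0.
rewrite big_nat_cond [leRHS]big_nat_cond; apply: ler_sum => r /andP[/andP[_ rm] _].
have [J HJ] := sum_residue_class N rm; rewrite !HJ.
have e j : (r + j * m)%N%:R * th = r%:R * th + 2 * j%:R * (m%:R * th / 2).
  by rewrite natrD natrM; field.
under eq_bigr => j _ do rewrite e.
under [X in _ + X ^+ 2]eq_bigr => j _ do rewrite e.
rewrite sqr_progression -[X in X ^+ 2]/(sin _) sin2cos2 gerBl.
exact: sqr_ge0.
Qed.

(* The Fejer kernel [F_J = modker 1 J (2 x)] satisfies
   [sin^2 x * F_j = sin^2 (j x)]. Summing over [j < J] gives [(J - C) / 2], where
   [C] is the real part of the Dirichlet sum whose square is at most [F_J]. *)
Lemma fejer_max J x : (0 < J)%N ->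
  let Psi := modker 1 J (2 * x) + J%:R^-1 * \sum_(0 <= j < J) modker 1 j (2 * x) in
  J%:R ^+ 2 <= 4 * Psi \/ 1 <= 4 * Psi * sin x ^+ 2.
Proof.
move=> J0 Psi; have JR : 0 < J%:R :> R by rewrite ltr0n.
have FE j : modker 1 j (2 * x) =
    (\sum_(0 <= i < j) cos (0 + 2 * i%:R * x)) ^+ 2 +
    (\sum_(0 <= i < j) sin (0 + 2 * i%:R * x)) ^+ 2.
  rewrite modker_classes // big_nat1.
  by congr (_ ^+ 2 + _ ^+ 2); apply: eq_big => [i|i _]; rewrite ?modn1 // add0r;
    congr (_ _); ring.
pose C := \sum_(0 <= i < J) cos (0 + 2 * i%:R * x).
have FJ : C ^+ 2 <= modker 1 J (2 * x) by rewrite FE lerDl sqr_ge0.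
have S0 : 0 <= J%:R^-1 * \sum_(0 <= j < J) modker 1 j (2 * x).
  by rewrite mulr_ge0 ?invr_ge0 // sumr_ge0 // => j _; exact: modker_ge0.
have SE : sin x ^+ 2 * \sum_(0 <= j < J) modker 1 j (2 * x) = (J%:R - C) / 2.
  rewrite mulr_sumr.
  under eq_bigr => j _ do rewrite FE sqr_progression sqr_sin_half.
  rewrite -mulr_suml sumrB sumr_const_nat subn0; congr ((_ - _) / _).
  by apply: eq_bigr => j _; congr cos; ring.
(* If C <= J / 2, then (J - C) / 2 >= J / 4 and the averaged kernels suffice; otherwise F_J >= C^2 >
   J^2 / 4. *)
have [CJ|CJ] := leP C (J%:R / 2); [right|left].
  have : 1 <= 4 * (J%:R^-1 * (sin x ^+ 2 * \sum_(0 <= j < J) modker 1 j (2 * x))).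
    rewrite SE (_ : 4 * (J%:R^-1 * ((J%:R - C) / 2)) = (2 * J%:R - 2 * C) / J%:R); last first.
      by field; rewrite gt_eqF.
    by rewrite ler_pdivlMr //; lra.
  move/le_trans; apply.
  rewrite -subr_ge0 /Psi; set F := modker 1 J _; set S := \sum_(0 <= j < J) _.
  rewrite (_ : _ - _ = 4 * (F * sin x ^+ 2)); last by ring.
  by rewrite mulr_ge0 // mulr_ge0 ?sqr_ge0 // modker_ge0.
have : J%:R ^+ 2 <= 4 * C ^+ 2 by nra.
by move=> h; rewrite /Psi; lra.
Qed.

End TrigonometricSums.

(** * Chebyshev's lower bound *)

Lemma central_bin_ge n : (4 ^ n <= (2 * n).+1 * 'C(2 * n, n))%N.
Proof.
elim: n => // n IH.
have e1 := mul_bin_diag (2 * n).+1 n.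
have e2 : 'C(2 * n.+1, n.+1) = (2 * 'C((2 * n).+1, n.+1))%N.
  have e3 : 'C((2 * n).+1, n) = 'C((2 * n).+1, n.+1).
    by rewrite -bin_sub; [congr 'C(_, _); lia | lia].
  by rewrite mulnS add2n binS e3; lia.
rewrite e2 expnS; rewrite /= in e1.
rewrite -(leq_pmul2l (ltn0Sn n)); nia.
Qed.

(** By Legendre's formula the exponent is the sum over k of [2n / p^k] - 2 [n / p^k]. Each term is 0
    or 1, and it is 0 once p^k > 2n. *)
Lemma central_bin_logn p n : prime p ->
  (p ^ logn p 'C(2 * n, n) <= (2 * n).+1)%N.
Proof.
move=> pp; have p1 := prime_gt1 pp.
have [->|n0] := posnP n; first by rewrite bin0 logn1.
have n20 : (0 < 2 * n)%N by rewrite muln_gt0.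
suff h : (logn p 'C(2 * n, n) <= trunc_log p (2 * n))%N.
  apply: (@leq_trans (p ^ trunc_log p (2 * n))); first by rewrite leq_exp2l.
  by apply: leq_trans (trunc_logP p1 n20) _.
have C0 : (0 < 'C(2 * n, n))%N by rewrite bin_gt0 leq_pmull.
have := @bin_fact (2 * n) n; rewrite leq_pmull // => /(_ isT).
rewrite (_ : 2 * n - n = n)%N; last by lia.
move/(congr1 (logn p)); rewrite !lognM ?muln_gt0 ?fact_gt0 // !logn_fact //.
have -> : (\sum_(1 <= k < n.+1) n %/ p ^ k = \sum_(1 <= k < (2 * n).+1) n %/ p ^ k)%N.
  rewrite [RHS](@big_cat_nat _ _ _ n.+1) //=; last by lia.
  rewrite [X in (_ + X)%N]big_nat_cond [X in (_ + X)%N]big1 ?addn0 // => k /andP[/andP[nk _] _].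
  by rewrite divn_small // (leq_trans nk) // ltnW // ltn_expl.
move=> e; have : (logn p 'C(2 * n, n) <=
    \sum_(1 <= k < (2 * n).+1) (k <= trunc_log p (2 * n)))%N.
  rewrite -(leq_add2r (\sum_(1 <= k < (2 * n).+1) n %/ p ^ k +
     \sum_(1 <= k < (2 * n).+1) n %/ p ^ k)) e -!big_split /=.
  rewrite leq_sum // => k _; have [h|h] := leqP k (trunc_log p (2 * n)).
    have pk : (0 < p ^ k)%N by rewrite expn_gt0 ltnW.
    rewrite -ltnS ltn_divLR //.
    have := divn_eq n (p ^ k); have := ltn_pmod n pk.
    by set q := (n %/ p ^ k)%N; set t := (n %% p ^ k)%N; nia.
  by rewrite divn_small // (leq_trans (trunc_log_ltn (2 * n) p1)) // leq_exp2l.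
move/leq_trans; apply.
have [h|h] := leqP (trunc_log p (2 * n)) (2 * n); last first.
  apply: leq_trans (ltnW h); rewrite -[leqRHS](subn0 _).
  apply: (@leq_trans (\sum_(1 <= k < (2 * n).+1) 1)%N).
    by apply: leq_sum => k _; case: (k <= _)%N.
  by rewrite sum_nat_const_nat muln1 subSS.
rewrite (@big_cat_nat _ _ _ (trunc_log p (2 * n)).+1) //=.
rewrite [X in (_ + X)%N]big_nat_cond [X in (_ + X)%N]big1 ?addn0; last first.
  by move=> k /andP[/andP[kn _] _]; rewrite leqNgt kn.
apply: (@leq_trans (\sum_(1 <= k < (trunc_log p (2 * n)).+1) 1)%N).
  by apply: leq_sum => k _; case: (k <= _)%N.
by rewrite sum_nat_const_nat muln1 subSS subn0.
Qed.

Section Chebyshev.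
Variable R : realType.

Lemma vonMangoldt_prime p : prime p -> vonMangoldt R p = ln p%:R.
Proof. by move=> pp; rewrite /vonMangoldt primes_prime. Qed.

Lemma vonMangoldt_ge0 n : 0 <= vonMangoldt R n.
Proof.
rewrite /vonMangoldt; case E : (primes n) => [//|p [|//]].
have : p \in primes n by rewrite E mem_head.
rewrite mem_primes => /and3P[/prime_gt0 p0 _ _].
by rewrite ln_ge0 // ler1n.
Qed.

Lemma ln_prod_seq (s : seq nat) (f : nat -> R) : (forall p, p \in s -> 0 < f p) ->
  ln (\prod_(p <- s) f p) = \sum_(p <- s) ln (f p).
Proof.
elim: s => [|p s IH] H; first by rewrite !big_nil ln1.
have H' q : q \in s -> 0 < f q by move=> qs; apply: H; rewrite inE qs orbT.
have P0 : 0 < \prod_(q <- s) f q by rewrite big_seq; apply: prodr_gt0.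
by rewrite !big_cons lnM ?posrE ?H ?mem_head // IH.
Qed.

(** Start from 1 - t <= exp(-t) at t = 0.68 / 32 and square five times, rounding down each time; the
    result is 1/2 <= exp(-0.68). *)
Lemma ln2_ge : 68 / 100 <= ln 2 :> R.
Proof.
pose t : R := 68 / 3200.
have t1 : 1 - t <= expR (- t) by exact: expR_ge1Dx.
have sqs (a b c : R) : 0 <= c -> c <= a ^+ 2 -> 0 <= a -> a <= expR b -> c <= expR (2 * b).
  move=> c0 ca a0 ab; apply: le_trans ca _.
  by rewrite mulr_natl mulr2n expRD -expr2 ler_sqr ?nnegrE ?expR_ge0.
have h1 : (95 / 100 + 79 / 100 ^+ 2) <= expR (2 * - t).
  by apply: (sqs (1 - t)) => //; rewrite /t; lra.
have h2 : (91 / 100 + 75 / 100 ^+ 2) <= expR (2 * (2 * - t)).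
  by apply: (sqs _ _ _ _ _ _ h1); lra.
have h3 : (84 / 100 + 17 / 100 ^+ 2) <= expR (2 * (2 * (2 * - t))).
  by apply: (sqs _ _ _ _ _ _ h2); lra.
have h4 : (70 / 100 + 83 / 100 ^+ 2) <= expR (2 * (2 * (2 * (2 * - t)))).
  by apply: (sqs _ _ _ _ _ _ h3); lra.
have h5 : 1 / 2 <= expR (2 * (2 * (2 * (2 * (2 * - t))))).
  by apply: (sqs _ _ _ _ _ _ h4); lra.
have e : 2 * (2 * (2 * (2 * (2 * - t)))) = - (68 / 100) by rewrite /t; field.
rewrite e expRN in h5.
rewrite -ler_expR lnK ?posrE //; have E0 := expR_gt0 (68 / 100 : R).
by move: h5; rewrite -(@ler_pM2r _ (expR (68 / 100))) // mulVf ?gt_eqF //; lra.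
Qed.

(** A prime p <= y contributes at most ln N, as its full power is at most N. A prime p > y >= sqrt N
    occurs only once, and ln p <= (ln p)^2 / ln y brings in the sum of squares. *)
Lemma ln_central_bin_le n N (y : R) : (2 * n < N)%N -> 1 < y -> N%:R <= y ^+ 2 ->
  ln 'C(2 * n, n)%:R <= y * ln N%:R +
    (\sum_(1 <= p < N.+1) vonMangoldt R p ^+ 2) / ln y.
Proof.
move=> nN y1 yN.
have lny : 0 < ln y by rewrite ln_gt0.
have N0 : (0 < N)%N by apply: leq_ltn_trans nN.
have lN : 0 <= ln N%:R :> R by rewrite ln_ge0 // ler1n.
have C0 : (0 < 'C(2 * n, n))%N by rewrite bin_gt0 leq_pmull.
pose G (p : nat) : R := (if p%:R <= y then ln N%:R else 0) + vonMangoldt R p ^+ 2 / ln y.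
have G0 p : 0 <= G p.
  rewrite /G addr_ge0 //; first by case: ifP.
  by rewrite divr_ge0 ?sqr_ge0 // ltW.
have -> : ln 'C(2 * n, n)%:R =
    \sum_(p <- primes 'C(2 * n, n)) ln (p%:R ^+ logn p 'C(2 * n, n)) :> R.
  rewrite -ln_prod_seq => [|p]; last first.
    by rewrite mem_primes => /andP[pp _]; rewrite exprn_gt0 // ltr0n prime_gt0.
  rewrite {1}(prod_prime_decomp C0) prime_decompE big_map natr_prod /=.
  by congr ln; apply: eq_bigr => p _; rewrite natrX.
have pN p : prime p -> (p ^ logn p 'C(2 * n, n) <= N)%N.
  by move=> pp; apply: leq_trans (central_bin_logn n pp) _.
apply: (@le_trans _ _ (\sum_(p <- primes 'C(2 * n, n)) G p)).
  rewrite big_seq [leRHS]big_seq; apply: ler_sum => p pC.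
  have pp : prime p by move: pC; rewrite mem_primes => /andP[].
  have p0 : 0 < p%:R :> R by rewrite ltr0n prime_gt0.
  have lpN : ln (p%:R ^+ logn p 'C(2 * n, n)) <= ln N%:R :> R.
    have := pN p pp; rewrite -(ler_nat R) natrX => h.
    by rewrite ler_ln ?posrE ?exprn_gt0 // ltr0n.
  rewrite /G; have [py|py] := leP (p%:R : R) y; first by rewrite (le_trans lpN) // lerDl divr_ge0 ?sqr_ge0 // ltW.
  rewrite add0r vonMangoldt_prime // (_ : logn _ _ = 1%N).
    rewrite expr1 ler_pdivlMr // expr2 ler_pM2l ?ler_ln ?posrE ?(lt_trans _ y1) //.
      exact: ltW.
    by rewrite ln_gt0 // ltr1n prime_gt1.
  apply/eqP; rewrite eqn_leq logn_gt0 pC andbT leqNgt; apply/negP => h.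
  have : (p ^ 2 <= N)%N by apply: leq_trans (pN p pp); rewrite leq_exp2l // prime_gt1.
  rewrite -(ler_nat R) natrX; apply/negP; rewrite -ltNge (le_lt_trans yN) //.
  by rewrite ltr_sqr // nnegrE ?(ltW p0) // (le_trans ler01) // ltW.
apply: (@le_trans _ _ (\sum_(1 <= p < N.+1) G p)).
  rewrite [leRHS](bigID (mem (primes 'C(2 * n, n)))) /=.
  rewrite -[X in X + _]big_filter -[leLHS]addr0 lerD //; last first.
    by apply: sumr_ge0.
  rewrite le_eqVlt; apply/orP; left; apply/eqP; apply: perm_big; apply: uniq_perm.
  - exact: primes_uniq.
  - by rewrite filter_uniq // iota_uniq.
  move=> p; rewrite mem_filter /= mem_index_iota ltnS.
  have [pC|//] := boolP (p \in primes _).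
  move: (pC); rewrite -logn_gt0 => l0.
  move: pC; rewrite mem_primes => /and3P[pp _ _]; rewrite prime_gt0 //=.
  apply/esym; apply: leq_trans (pN p pp).
  by rewrite -{1}[p]expn1 leq_exp2l // prime_gt1.
rewrite /G big_split /= mulr_suml lerD //.
rewrite -big_mkcond /=; apply: (@le_trans _ _ (\sum_(1 <= p < N.+1 | p%:R <= y) 1 * ln N%:R)).
  by apply: ler_sum => p _; rewrite mul1r.
rewrite -mulr_suml ler_wpM2r //; apply: sum1_le.
by rewrite (le_trans ler01) // ltW.
Qed.

Lemma sum_vonMangoldt_sqr_ge N : 10 ^+ 7 <= ln N%:R :> R ->
  66 / 100 * (N%:R * ln N%:R) <= \sum_(1 <= n < N.+1) vonMangoldt R n ^+ 2.
Proof.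
set l : R := ln N%:R => hl; set D := \sum_(1 <= n < _) _.
have N0 : (0 < N)%N.
  rewrite lt0n; apply/eqP => N0; move: hl; rewrite /l N0 ln0 //; lra.
have NE : N%:R = expR l by rewrite /l lnK // posrE ltr0n.
have l0 : 0 <= l by lra.
(* The largest n with 2n + 1 <= N, the bound on prime powers in the binomial coefficient. *)
pose n := (N.-1)./2.
(* y = N^0.98 keeps y l negligible against N, while 0.98 (0.68 - 0.005) = 0.6615 still exceeds
   0.66. *)
pose y : R := expR (98 / 100 * l).
have y1 : 1 < y by rewrite /y expR_gt1; lra.
have lny : ln y = 98 / 100 * l by rewrite /y expRK.
have sqle (x : R) : 0 <= x -> x ^+ 2 / 4 <= expR x.
  move=> x0; have -> : expR x = expR (x / 2) ^+ 2.
    by rewrite expr2 -expRD; congr expR; lra.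
  have : x / 2 <= expR (x / 2) by have := expR_ge1Dx (x / 2); lra.
  have := expR_ge0 (x / 2); nra.
have nN : (2 * n < N)%N by rewrite /n; move: N0; clear; lia.
have nN2 : (N <= 2 * n + 2)%N by rewrite /n; clear; lia.
have yN : N%:R <= y ^+ 2.
  by rewrite NE /y expr2 -expRD ler_expR; lra.
have := ln_central_bin_le nN y1 yN; rewrite -/D -/l lny => hC.
have yl : y * l <= 4 / 1000 * N%:R.
  have -> : N%:R = y * expR (2 / 100 * l).
    by rewrite NE /y -expRD; congr expR; lra.
  rewrite mulrCA ler_pM2l; last by lra.
  have := sqle (2 / 100 * l); nra.
have Nl : l <= 1 / 100 ^+ 2 * N%:R by rewrite NE; have := sqle l l0; nra.
have bl : ln 2 * (N%:R - 2) - ln 2 - l <= ln 'C(2 * n, n)%:R.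
  have := central_bin_ge n; rewrite -(ler_nat R) natrX natrM => h.
  have C0 : 0 < 'C(2 * n, n)%:R :> R by rewrite ltr0n bin_gt0 leq_pmull.
  have N2 : 0 < (2 * n).+1%:R :> R by rewrite ltr0n.
  move: h; rewrite -ler_ln ?posrE ?exprn_gt0 ?mulr_gt0 // lnM ?posrE // lnXn //.
  have -> : ln 4 = 2 * ln 2 :> R.
    by rewrite (_ : 4 = 2 ^+ 2 :> R) ?lnXn // ?mulr_natl //; ring.
  have : ln (2 * n).+1%:R <= l by rewrite /l ler_ln ?posrE ?ltr0n // ler_nat.
  have : N%:R - 2 <= 2 * n%:R :> R.
    by rewrite lerBlDr -natrM -natrD ler_nat.
  have := ln2_ge; rewrite -[_ *+ n]mulr_natl; nra.
have D1 : 98 / 100 * l * (ln 'C(2 * n, n)%:R - y * l) <= D.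
  by move: hC; rewrite -lerBlDl ler_pdivlMr 1?mulrC //; lra.
have l2 : ln 2 <= 1 :> R by have := @le_ln1Dx R 1; rewrite (_ : 1 + 1 = 2) //; lra.
have := ln2_ge => l2'.
have D2 : (68 / 100 - 5 / 1000) * N%:R <= ln 'C(2 * n, n)%:R - y * l.
  have : l * l >= 10 ^+ 7 * l by nra.
  nra.
apply: le_trans D1; nra.
Qed.

End Chebyshev.

(** * Means over a grid *)

Section GridMean.
Variables (R : realType) (M : nat).
Hypothesis M_gt0 : (0 < M)%N.
Implicit Types f g : R -> R.
Local Notation mean := (@grid_mean R M).

Lemma eq_grid_mean f g : f =1 g -> mean f = mean g.
Proof. by move=> fg; congr (_ * _); apply: eq_bigr => j _. Qed.

Lemma grid_meanD f g : mean (fun th => f th + g th) = mean f + mean g.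
Proof. by rewrite /grid_mean big_split mulrDr. Qed.

Lemma grid_meanZ c f : mean (fun th => c * f th) = c * mean f.
Proof. by rewrite /grid_mean -mulr_sumr mulrCA. Qed.

Lemma grid_mean_cst c : mean (fun=> c) = c.
Proof.
rewrite /grid_mean sumr_const_nat subn0 -[c *+ M]mulr_natl mulKf //.
by rewrite pnatr_eq0 -lt0n.
Qed.

Lemma grid_mean_sum (I : Type) (s : seq I) (P : pred I) (F : I -> R -> R) :
  mean (fun th => \sum_(i <- s | P i) F i th) = \sum_(i <- s | P i) mean (F i).
Proof. by rewrite /grid_mean exchange_big /= mulr_sumr. Qed.

Lemma ler_grid_mean f g : (forall th, f th <= g th) -> mean f <= mean g.
Proof.
move=> fg; rewrite ler_wpM2l ?invr_ge0 //; apply: ler_sum => j _; exact: fg.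
Qed.

Lemma grid_mean_modker m N c : (0 < m)%N -> (0 < c)%N -> (c * N <= M)%N ->
  mean (fun th => modker m N (c%:R * th)) = N%:R.
Proof.
move=> m0 c0 cNM.
under eq_grid_mean => th do rewrite modker_fourier //.
rewrite grid_meanD grid_mean_cst grid_meanZ grid_mean_sum.
rewrite big_nat_cond big1 ?mulr0 ?addr0 // => k /andP[/andP[k0 kN] _].
rewrite grid_meanZ (_ : mean _ = 0) ?mulr0 //.
under eq_grid_mean => th do rewrite mulrA -natrM.
apply: grid_mean_cos; rewrite muln_gt0 k0 c0 /=.
by apply: leq_trans cNM; rewrite mulnC ltn_pmul2l.
Qed.

Lemma grid_mean_cosM k l : (0 < k)%N -> (0 < l)%N -> (k + l < M)%N ->
  mean (fun th => cos (k%:R * th) * cos (l%:R * th)) = (k == l)%:R / 2.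
Proof.
move=> k0 l0 klM.
under eq_grid_mean => th.
  rewrite (_ : _ * _ = 2^-1 * cos ((k + l)%N%:R * th) +
                       2^-1 * cos ((k%:R - l%:R) * th)); last first.
    by rewrite natrD mulrDl mulrBl cosD cosB; field.
  over.
rewrite grid_meanD !grid_meanZ grid_mean_cos ?addn_gt0 ?k0 // mulr0 add0r mulrC.
congr (_ / _); have [->|kl] := eqVneq k l.
  under eq_grid_mean => th do rewrite subrr mul0r cos0.
  exact: grid_mean_cst.
wlog lk : k l k0 l0 klM kl / (l < k)%N.
  move=> H; move: (kl); rewrite neq_ltn => /orP[kl'|]; last exact: H.
  under eq_grid_mean => th do rewrite -cosN -mulNr opprB.
  by apply: H => //; rewrite 1?addnC // eq_sym.
under eq_grid_mean => th do rewrite -natrB ?(ltnW lk) //.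
by apply: grid_mean_cos; rewrite subn_gt0 lk /=; lia.
Qed.

(** Parseval's identity; with 2 K < M no two frequencies of the square are confused on the grid. *)
Lemma grid_mean_sqr (c : R) (a : nat -> R) K : (2 * K < M)%N ->
  mean (fun th => (c + 2 * \sum_(1 <= k < K.+1) a k * cos (k%:R * th)) ^+ 2) =
  c ^+ 2 + 2 * \sum_(1 <= k < K.+1) a k ^+ 2.
Proof.
move=> KM; under eq_grid_mean => th.
  rewrite (_ : _ ^+ 2 = c ^+ 2 + 4 * c * \sum_(1 <= k < K.+1) a k * cos (k%:R * th) +
     4 * \sum_(1 <= k < K.+1) \sum_(1 <= l < K.+1)
       a k * a l * (cos (k%:R * th) * cos (l%:R * th))); last first.
    set T := \sum_(1 <= k < _) a k * _.
    have -> : \sum_(1 <= k < K.+1) \sum_(1 <= l < K.+1)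
       a k * a l * (cos (k%:R * th) * cos (l%:R * th)) = T * T.
      rewrite big_distrlr; apply: eq_bigr => k _; apply: eq_bigr => l _ /=.
      by rewrite mulrACA.
    by ring.
  over.
rewrite !grid_meanD grid_mean_cst !grid_meanZ !grid_mean_sum.
rewrite [X in _ + _ * X + _]big_nat_cond [X in _ + _ * X + _]big1; last first.
  move=> k /andP[/andP[k0 kK] _]; rewrite grid_meanZ grid_mean_cos ?mulr0 //.
  by rewrite k0 /=; lia.
rewrite mulr0 addr0; congr (_ + _).
rewrite (_ : 4 = 2 * 2) -?mulrA; last by ring.
congr (_ * _); rewrite mulr_sumr; apply: eq_big_nat => k /andP[k0 kK].
rewrite grid_mean_sum (bigD1_seq k) ?iota_uniq ?mem_index_iota ?k0 //=.
rewrite big_nat_cond big1 ?addr0; last first.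
  move=> l /andP[/andP[l0 lK] lk]; rewrite grid_meanZ grid_mean_cosM //; last by lia.
  by rewrite eq_sym (negbTE lk) mul0r mulr0.
rewrite grid_meanZ grid_mean_cosM //; last by lia.
by rewrite eqxx /=; field.
Qed.

End GridMean.

(** * Fourier expansion of |S|^2 and of the model V *)

Section Decomposition.
Variables (R : realType) (N : nat).
Local Notation vM := (vonMangoldt R).

Definition sqS (th : R) : R :=
  (\sum_(1 <= n < N.+1) vM n * cos (n%:R * th)) ^+ 2 +
  (\sum_(1 <= n < N.+1) vM n * sin (n%:R * th)) ^+ 2.

Definition sum_sqr : R := \sum_(1 <= n < N.+1) vM n ^+ 2.

Definition err (k : nat) : R :=
  psi2 R N k%:Z - singular_series R k%:Z * (N%:R - k%:R).

Lemma psi2N (k : int) : psi2 R N (- k) = psi2 R N k.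
Proof.
rewrite /psi2 (exchange_big_dep_nat xpredT) //=; apply: eq_bigr => n _.
apply: eq_big => [n'|n' _]; last by rewrite mulrC.
by rewrite -eqr_opp opprB opprK.
Qed.

Lemma pair_errorE : pair_error R N = 2 * \sum_(1 <= k < N.+1) err k ^+ 2.
Proof.
rewrite /pair_error mulr_sumr; apply: eq_bigr => k _.
have sN : singular_series R (- k%:Z) = singular_series R k%:Z.
  by rewrite /singular_series abszN.
rewrite big_cons big_seq1 sN psi2N normrN ger0_norm // -pmulrn -/(err k).
ring.
Qed.

Lemma sqS_fourier th :
  sqS th = sum_sqr + 2 * \sum_(1 <= k < N.+1) psi2 R N k%:Z * cos (k%:R * th).
Proof.
rewrite /sqS sqr_trig_sum /=.
pose c (z : int) n n' : R := if n'%:Z - n%:Z == z then vM n * vM n' else 0.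
have -> : 2 * \sum_(1 <= k < N.+1) psi2 R N k%:Z * cos (k%:R * th) =
   \sum_(1 <= n < N.+1) \sum_(1 <= n' < N.+1) \sum_(1 <= k < N.+1)
     (c k%:Z n n' + c (- k%:Z) n n') * cos (k%:R * th).
  transitivity (\sum_(1 <= k < N.+1) \sum_(1 <= n < N.+1) \sum_(1 <= n' < N.+1)
     (c k%:Z n n' + c (- k%:Z) n n') * cos (k%:R * th)); last first.
    by rewrite exchange_big /=; apply: eq_bigr => n _; rewrite exchange_big.
  rewrite mulr_sumr; apply: eq_bigr => k _.
  rewrite -[RHS]/(_) mulrA; transitivity ((psi2 R N k%:Z + psi2 R N (- k%:Z)) * cos (k%:R * th)).
    by rewrite psi2N; ring.
  rewrite mulrDl /psi2 !mulr_suml -big_split; apply: eq_bigr => n _ /=.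
  by rewrite -mulrDl big_mkcond [X in _ + X]big_mkcond -big_split /= mulr_suml.
rewrite /sum_sqr -big_split; apply: eq_big_nat => n /andP[n0 nN] /=.
have -> : vM n ^+ 2 = \sum_(1 <= n' < N.+1) (if n == n' then vM n * vM n' else 0).
  rewrite (bigD1_seq n) ?iota_uniq ?mem_index_iota ?n0 //= eqxx big1 ?addr0 ?expr2 //.
  by move=> n' /negbTE; rewrite eq_sym => ->.
rewrite -big_split; apply: eq_big_nat => n' /andP[n'0 n'N] /=.
have [<-|nn'] := eqVneq n n'.
  rewrite subrr mul0r cos0 mulr1 big_nat_cond big1 ?addr0 // => k /andP[/andP[k0 _] _].
  rewrite /c subrr !(eq_sym (0 : int)) oppr_eq0 eqz_nat (gtn_eqF k0).
  by rewrite addr0 mul0r.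
rewrite add0r (bigD1_seq `|n - n'|%N) ?iota_uniq //=; last first.
  by rewrite mem_index_iota; lia.
rewrite big_nat_cond big1 ?addr0; last first.
  move=> k /andP[/andP[k0 _] kn]; rewrite /c.
  rewrite ifF; last by apply/negP => /eqP h; move/negP: kn; apply; apply/eqP; lia.
  rewrite ifF; last by apply/negP => /eqP h; move/negP: kn; apply; apply/eqP; lia.
  by rewrite addr0 mul0r.
rewrite /c; have [h|h] := leqP n n'.
  have lt : (n < n')%N by rewrite ltn_neqAle nn'.
  rewrite distnEr // ifT; last by apply/eqP; lia.
  rewrite ifF; last by apply/negP => /eqP; lia.
  by rewrite addr0 natrB // -cosN -mulNr opprB.
rewrite distnEl ?(ltnW h) // ifF; last by apply/negP => /eqP; lia.
rewrite ifT; last by apply/eqP; lia.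
by rewrite add0r natrB // ltnW.
Qed.

Definition swt_part (a b : nat) (th : R) : R :=
  \sum_(a <= d < b) swt R d * modker (2 * d) N th.

Lemma swt_part_fourier a b th : (0 < a)%N ->
  swt_part a b th = N%:R * \sum_(a <= d < b) swt R d +
    2 * \sum_(1 <= k < N.+1)
      ((N - k)%:R * \sum_(a <= d < b | (2 * d %| k)%N) swt R d) * cos (k%:R * th).
Proof.
move=> a0; rewrite /swt_part.
have -> : \sum_(1 <= k < N.+1)
      ((N - k)%:R * \sum_(a <= d < b | (2 * d %| k)%N) swt R d) * cos (k%:R * th) =
   \sum_(a <= d < b) swt R d * \sum_(1 <= k < N | (2 * d %| k)%N) (N - k)%:R * cos (k%:R * th).
  transitivity (\sum_(1 <= k < N.+1) \sum_(a <= d < b | (2 * d %| k)%N)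
      swt R d * ((N - k)%:R * cos (k%:R * th))).
    apply: eq_bigr => k _; rewrite mulrAC mulr_sumr; apply: eq_bigr => d _.
    exact: mulrC.
  rewrite (exchange_big_dep_nat xpredT) //=; apply: eq_bigr => d _.
  rewrite mulr_sumr; have [->|N0] := posnP N; first by rewrite !big_geq.
  (* The kernel stops at k = N - 1; the extra frequency k = N has weight N - k = 0. *)
  rewrite big_mkcond big_nat_recr //= -big_mkcond /= subnn mul0r mulr0.
  by case: ifP; rewrite addr0.
rewrite !mulr_sumr -big_split; apply: eq_big_nat => d /andP[ad _] /=.
rewrite modker_fourier; last by rewrite muln_gt0; apply: leq_trans ad.
by ring.
Qed.

(** Compare the coefficients of cos(k th). The last constant is the difference of the diagonals,
    that of |S|^2 and that of V. *)
Lemma sqS_decomp Z th : (Z <= N)%N ->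
  sqS th = 2 * \sum_(1 <= k < N.+1) err k * cos (k%:R * th) +
    swt_part 1 Z.+1 th + swt_part Z.+1 N.+1 th +
    (sum_sqr - N%:R * \sum_(1 <= d < N.+1) swt R d).
Proof.
move=> ZN; rewrite -[X in X + _]addrA -(@big_cat_nat _ _ _ Z.+1) //=.
rewrite -/(swt_part 1 N.+1 th) swt_part_fourier // sqS_fourier.
rewrite (_ : \sum_(1 <= k < N.+1) psi2 R N k%:Z * cos (k%:R * th) =
  \sum_(1 <= k < N.+1) err k * cos (k%:R * th) +
  \sum_(1 <= k < N.+1) ((N - k)%:R *
     \sum_(1 <= d < N.+1 | (2 * d %| k)%N) swt R d) * cos (k%:R * th)); first by ring.
rewrite -big_split; apply: eq_big_nat => k /andP[k0 kN] /=.
rewrite -singular_seriesE ?k0 // /err natrB //; ring.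
Qed.

End Decomposition.

(** * Mean square of the divisors above the cutoff *)

Section LargeDivisors.
Variable R : realType.

Lemma sumr_indic (I : Type) (s : seq I) (P : pred I) (F : I -> R) :
  \sum_(i <- s | P i) F i = \sum_(i <- s) (P i)%:R * F i.
Proof.
by rewrite big_mkcond; apply: eq_bigr => i _; case: (P i); rewrite ?mul1r ?mul0r.
Qed.

(* The gcd produced by counting common multiples is bounded by the sum of all
   the common divisors, which decouples the two variables. *)
Lemma sum_sqr_divisors_le (v : nat -> R) N : (forall d, 0 <= v d) ->
  \sum_(1 <= k < N.+1) (\sum_(1 <= d < N.+1 | (d %| k)%N) v d) ^+ 2 <=
  N%:R * \sum_(1 <= g < N.+1)
    g%:R * (\sum_(1 <= d < N.+1 | (g %| d)%N) v d / d%:R) ^+ 2.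
Proof.
move=> v0.
under eq_bigr => k _ do rewrite sumr_indic expr2 big_distrlr /=.
under [X in _ <= _ * X]eq_bigr => g _.
  rewrite sumr_indic expr2 big_distrlr mulr_sumr /=.
  under eq_bigr => d _ do rewrite mulr_sumr.
  over.
rewrite exchange_big [X in _ <= _ * X]exchange_big mulr_sumr /=.
apply: ler_sum_nat => d /andP[d0 dN]; rewrite exchange_big [X in _ <= _ * X]exchange_big mulr_sumr /=.
apply: ler_sum_nat => d' /andP[d'0 d'N].
have dR : 0 < d%:R :> R by rewrite ltr0n.
have d'R : 0 < d'%:R :> R by rewrite ltr0n.
have g0 : (0 < gcdn d d')%N by rewrite gcdn_gt0 d0.
have l0 : (0 < lcmn d d')%N by rewrite lcmn_gt0 d0.
apply: (@le_trans _ _ (v d * v d' * (N%:R / (lcmn d d')%:R))).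
  rewrite (_ : \sum_(1 <= k < N.+1) _ =
      v d * v d' * \sum_(1 <= k < N.+1 | (lcmn d d' %| k)%N) 1).
    by rewrite ler_wpM2l ?mulr_ge0 // sum_multiples1_le.
  rewrite mulr_sumr [RHS]sumr_indic; apply: eq_bigr => k _.
  by rewrite dvdn_lcm; case: (d %| k)%N; case: (d' %| k)%N => /=; ring.
rewrite (bigD1_seq (gcdn d d')) ?iota_uniq ?mem_index_iota ?g0 //=; last first.
  by apply: leq_ltn_trans dN; rewrite dvdn_leq // dvdn_gcdl.
rewrite dvdn_gcdl dvdn_gcdr mulrDr -[leLHS]addr0; apply: lerD; last first.
  rewrite mulr_ge0 // sumr_ge0 // => g _.
  by rewrite !mulr_ge0 ?invr_ge0.
have -> : (lcmn d d')%:R^-1 = (gcdn d d')%:R / (d%:R * d'%:R) :> R.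
  rewrite -natrM -muln_lcm_gcd natrM invfM mulrCA divff ?mulr1 //.
  by rewrite pnatr_eq0 -lt0n.
rewrite le_eqVlt /=; apply/orP; left; apply/eqP; field.
by rewrite !gt_eqF.
Qed.

(** By positivity 2 d | k may be relaxed to d | k. After decoupling, two factors exp 8 come from the
    squared inner tail and one from the outer sum of [dwt g ^+ 2 / g]. *)
Lemma sum_sqr_swt_tail_le N Z : (0 < Z <= N)%N ->
  \sum_(1 <= k < N.+1)
    (\sum_(Z.+1 <= d < N.+1 | (2 * d %| k)%N) swt R d) ^+ 2 <=
  9 * expR 8 ^+ 3 * (N%:R * (1 + ln N%:R)) / Z%:R ^+ 2.
Proof.
case/andP=> Z0 ZN; have N0 := leq_trans Z0 ZN.
have ZR : 0 < Z%:R :> R by rewrite ltr0n.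
pose v d : R := if (Z < d)%N then swt R d else 0.
have v0 d : 0 <= v d by rewrite /v; case: ifP => // _; exact: swt_ge0.
apply: (@le_trans _ _ (\sum_(1 <= k < N.+1) (\sum_(1 <= d < N.+1 | (d %| k)%N) v d) ^+ 2)).
  apply: ler_sum => k _; rewrite ler_sqr ?nnegrE ?sumr_ge0 //; last first.
    by move=> d _; exact: swt_ge0.
  rewrite [leRHS](@big_cat_nat _ _ _ Z.+1) //= -[leLHS]add0r lerD ?sumr_ge0 //.
  rewrite big_nat_cond big_mkcond [leRHS]big_nat_cond [leRHS]big_mkcond /=.
  apply: ler_sum => d _; rewrite /v; case: (leqP Z.+1 d) => //= Zd.
  case: (d < N.+1)%N => //=; case: ifP => h.
    by rewrite (dvdn_trans _ h) // dvdn_mull.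
  by case: ifP => // _; exact: swt_ge0.
apply: le_trans (sum_sqr_divisors_le N v0) _.
rewrite -[_ * (N%:R * _)]mulrCA -mulrA ler_wpM2l //.
have K0 := expR_ge0 (8 : R); set K := expR 8 in K0 *.
apply: (@le_trans _ _ (\sum_(1 <= g < N.+1) 9 * K ^+ 2 / Z%:R ^+ 2 * (dwt R g ^+ 2 / g%:R))).
  apply: ler_sum_nat => g /andP[g0 gN]; have gR : 0 < g%:R :> R by rewrite ltr0n.
  (* With d = g b, submultiplicativity of [dwt] separates g, and the tail over b > Z / g is at most
     2 exp(8) g / Z. *)
  have T : \sum_(1 <= d < N.+1 | (g %| d)%N) v d / d%:R <=
      3 * K * dwt R g / (g%:R * Z%:R).
    rewrite (sum_multiples (fun d => v d / d%:R)) //.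
    have Zg : 0 < Z%:R / g%:R :> R by rewrite divr_gt0.
    apply: (@le_trans _ _ (3 / 2 * (dwt R g / g%:R ^+ 2) *
        \sum_(1 <= b < N.+1 | (Z%:R / g%:R : R) < b%:R) dwt R b / b%:R ^+ 2)).
      rewrite mulr_sumr big_mkcond [leRHS]big_mkcond; apply: ler_sum_nat => b /andP[b0 _].
      have bR : 0 < b%:R :> R by rewrite ltr0n.
      have t0 : 0 <= 3 / 2 * (dwt R g / g%:R ^+ 2) * (dwt R b / b%:R ^+ 2).
        by rewrite !mulr_ge0 ?dwt_ge0 ?invr_ge0 ?sqr_ge0.
      rewrite /= ltr_pdivrMr // -natrM ltr_nat /v mulnC.
      case: (Z < b * g)%N; last by rewrite mul0r; case: ifP.
      case: ifP => _ //.
      have bg0 : (0 < b * g)%N by rewrite muln_gt0 b0.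
      apply: (@le_trans _ _ (3 / 2 * (dwt R (b * g) / (b * g)%:R) / (b * g)%:R)).
        by rewrite ler_wpM2r ?invr_ge0 // swt_le_dwt.
      apply: (@le_trans _ _ (3 / 2 * (dwt R b * dwt R g / (b * g)%:R) / (b * g)%:R)).
        rewrite ler_wpM2r ?invr_ge0 //; apply: ler_wpM2l; first by lra.
        by rewrite ler_wpM2r ?invr_ge0 // dwt_mul_le.
      rewrite natrM le_eqVlt; apply/orP; left; apply/eqP; field.
      by rewrite !gt_eqF.
    apply: le_trans (ler_wpM2l _ (sum_dwt_tail_le N Zg)) _.
      by rewrite !mulr_ge0 ?dwt_ge0 ?invr_ge0 ?sqr_ge0.
    rewrite -/K le_eqVlt; apply/orP; left; apply/eqP; field.
    by rewrite !gt_eqF.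
  apply: (@le_trans _ _ (g%:R * (3 * K * dwt R g / (g%:R * Z%:R)) ^+ 2)).
    rewrite ler_wpM2l // ler_sqr ?nnegrE //.
      by apply: sumr_ge0 => d _; rewrite divr_ge0.
    by rewrite divr_ge0 ?mulr_ge0 ?dwt_ge0 // ltW.
  rewrite le_eqVlt; apply/orP; left; apply/eqP; field.
  by rewrite !gt_eqF.
rewrite -mulr_sumr; apply: le_trans (ler_wpM2l _ (sum_dwt_sqr_inv_le R N0)) _.
  by rewrite !mulr_ge0 ?invr_ge0 ?sqr_ge0 //.
rewrite -/K le_eqVlt; apply/orP; left; apply/eqP; field.
by rewrite !gt_eqF.
Qed.

End LargeDivisors.

(** * Moments of the pieces, and the measure of the exceptional set *)

Section Moments.
Variables (R : realType) (N Z J M : nat).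
Hypotheses (Z_gt0 : (0 < Z)%N) (ZN : (Z <= N)%N) (J_gt0 : (0 < J)%N)
  (NM : (2 * N * J.+1 < M)%N).
Local Notation mean := (@grid_mean R M).
Local Notation K := (expR 8 : R).
Local Notation l := (ln N%:R : R).

Let M_gt0 : (0 < M)%N. Proof. exact: leq_ltn_trans NM. Qed.
Let NM2 : (2 * N < M)%N. Proof. by apply: leq_ltn_trans NM; rewrite leq_pmulr. Qed.

(** By [fejer_max], four times this dominates the smaller of J^2 and 1 / sin^2(d th). Being a
    trigonometric polynomial, it has an exactly computable grid mean, of order J. *)
Definition fejer_avg (d : nat) (th : R) : R :=
  modker 1 J (2 * (d%:R * th)) +
  J%:R^-1 * \sum_(0 <= j < J) modker 1 j (2 * (d%:R * th)).

Lemma fejer_avg_ge0 d th : 0 <= fejer_avg d th.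
Proof.
by rewrite addr_ge0 ?modker_ge0 // mulr_ge0 ?invr_ge0 // sumr_ge0 // => j _; exact: modker_ge0.
Qed.

Lemma mean_fejer_avg_le d : (0 < d <= N)%N -> mean (fejer_avg d) <= 2 * J%:R.
Proof.
case/andP=> d0 dN.
have H j : (j <= J)%N -> mean (fun th => modker 1 j (2 * (d%:R * th))) = j%:R.
  move=> jJ; rewrite -[RHS](@grid_mean_modker R M M_gt0 1 j (2 * d)) ?muln_gt0 //.
    by apply: eq_grid_mean => th; rewrite natrM mulrA.
  apply: leq_trans (ltnW NM); rewrite leq_mul ?leq_mul //.
  by rewrite (leq_trans jJ).
rewrite /fejer_avg grid_meanD H // grid_meanZ grid_mean_sum.
rewrite mulr_natl mulr2n lerD2l mulrC ler_pdivrMr ?ltr0n //.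
apply: (@le_trans _ _ (\sum_(0 <= j < J) J%:R)).
  by apply: ler_sum_nat => j /andP[_ jJ]; rewrite H ?ler_nat ltnW.
by rewrite sumr_const_nat subn0 mulr_natr.
Qed.

(** Either some d with [dwt d != 0] has 4 [fejer_avg] >= J^2 >= X, and its term alone reaches X; or
    every such d satisfies G_2d <= 2 d / sin^2 <= 8 d [fejer_avg], and u(d) <= (3/2) [dwt d] / d
    gives 12 = (3/2) 8 term by term. *)
Lemma swt_part_large (X : R) th : X <= J%:R ^+ 2 -> X < swt_part N 1 Z.+1 th ->
  X <= \sum_(1 <= d < Z.+1) 12 * dwt R d * fejer_avg d th.
Proof.
move=> XJ XV.
have t0 d : 0 <= 12 * dwt R d * fejer_avg d th.
  by rewrite !mulr_ge0 ?dwt_ge0 ?fejer_avg_ge0.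
have [/hasP[d]|/hasPn H] := boolP (has (fun d => (dwt R d != 0) &&
    (J%:R ^+ 2 <= 4 * fejer_avg d th)) (index_iota 1 Z.+1)).
  move=> dZ /andP[dw JP]; rewrite (bigD1_seq d) ?iota_uniq //=.
  have := dwt_ge1 dw; have := fejer_avg_ge0 d th => f0 w1.
  have : 0 <= \sum_(1 <= i < Z.+1 | i != d) 12 * dwt R i * fejer_avg i th.
    by apply: sumr_ge0.
  nra.
apply: le_trans (ltW XV) _; apply: ler_sum_nat => d /andP[d0 dZ].
have [w0|w0] := eqVneq (dwt R d) 0.
  have := swt_le_dwt R d0; rewrite w0 mul0r mulr0 => s0.
  have -> : swt R d = 0 by apply/eqP; rewrite eq_le s0 swt_ge0.
  by rewrite !(mul0r, mulr0).
have [|h] := fejer_max (d%:R * th) J_gt0.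
  move=> h; have := H d; rewrite mem_index_iota d0 dZ w0 => /(_ isT) /=.
  by rewrite h.
have d20 : (0 < 2 * d)%N by rewrite muln_gt0.
have := sqr_sin_modker N th d20; have := modker_ge0 N th d20.
rewrite natrM (_ : 2 * d%:R * th / 2 = d%:R * th); last by field.
have := h; rewrite -/(fejer_avg d th); have := fejer_avg_ge0 d th.
set P := fejer_avg d th; set G := modker (2 * d) N th; set s := sin _ ^+ 2.
move=> P0 h1 G0 sG.
have GP : G <= 8 * d%:R * P.
  apply: (@le_trans _ _ (4 * P * (s * G))); first by nra.
  have : P * (s * G) <= P * (2 * d%:R) by rewrite ler_wpM2l.
  lra.
apply: (@le_trans _ _ (3 / 2 * (dwt R d / d%:R) * G)).
  by rewrite ler_wpM2r // swt_le_dwt.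
have dR : 0 < d%:R :> R by rewrite ltr0n.
have w1 := dwt_ge0 R d.
apply: (@le_trans _ _ (3 / 2 * (dwt R d / d%:R) * (8 * d%:R * P))).
  by apply: ler_wpM2l GP; rewrite mulr_ge0 ?divr_ge0.
by rewrite le_eqVlt; apply/orP; left; apply/eqP; field; rewrite gt_eqF.
Qed.

(** Markov's inequality for the majorant: each d <= Z costs 24 J [dwt d], and the [dwt d] add up to
    O(Z). *)
Lemma mean_large_le (X : R) : 0 < X -> X <= J%:R ^+ 2 ->
  X * mean (fun th => (X < swt_part N 1 Z.+1 th)%R%:R) <= 24 * K * (J * Z)%:R.
Proof.
move=> X0 XJ; rewrite -grid_meanZ.
apply: (@le_trans _ _ (mean (fun th => \sum_(1 <= d < Z.+1) 12 * dwt R d * fejer_avg d th))).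
  apply: ler_grid_mean => th; case: ltP => XV.
    by rewrite mulr1; exact: swt_part_large.
  by rewrite mulr0 sumr_ge0 // => d _; rewrite !mulr_ge0 ?dwt_ge0 ?fejer_avg_ge0.
rewrite grid_mean_sum; apply: (@le_trans _ _ (\sum_(1 <= d < Z.+1) 24 * J%:R * dwt R d)).
  apply: ler_sum_nat => d /andP[d0 dZ]; rewrite grid_meanZ.
  have := @mean_fejer_avg_le d; rewrite d0 (leq_trans _ ZN) // => /(_ isT) h.
  have := dwt_ge0 R d; nra.
rewrite -mulr_sumr.
have : \sum_(1 <= d < Z.+1) dwt R d <= K * Z%:R.
  apply: le_trans (sum_dwt_le Z (ler0n R Z)); rewrite [leRHS]big_mkcond.
  by apply: ler_sum_nat => d /andP[_ dZ]; rewrite ler_nat -ltnS dZ.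
have J0 : 0 <= J%:R :> R by [].
rewrite natrM; nra.
Qed.

Lemma mean_swt_part1 : mean (swt_part N 1 Z.+1) = N%:R * \sum_(1 <= d < Z.+1) swt R d.
Proof.
rewrite /swt_part grid_mean_sum mulr_sumr; apply: eq_big_nat => d /andP[d0 dZ].
rewrite grid_meanZ mulrC; congr (_ * _).
rewrite -[RHS](@grid_mean_modker R M M_gt0 (2 * d) N 1) ?muln_gt0 //.
  by apply: eq_grid_mean => th; rewrite mul1r.
by rewrite mul1n; lia.
Qed.

Lemma mean_sqS : mean (sqS N) = sum_sqr R N.
Proof.
under eq_grid_mean => th do rewrite sqS_fourier.
rewrite grid_meanD grid_mean_cst // grid_meanZ grid_mean_sum.
rewrite big_nat_cond big1 ?mulr0 ?addr0 // => k /andP[/andP[k0 kN] _].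
by rewrite grid_meanZ grid_mean_cos ?mulr0 // k0 /=; lia.
Qed.

Lemma mean_err_sqr :
  mean (fun th => (2 * \sum_(1 <= k < N.+1) err R N k * cos (k%:R * th)) ^+ 2) =
  pair_error R N.
Proof.
under eq_grid_mean => th do rewrite -[2 * _]add0r.
by rewrite grid_mean_sqr // expr0n add0r pair_errorE.
Qed.

(** The lower bound on Z makes N (1 + l) / Z^2 at most 8 l^2. The 4 pays for the constant term, at
    most 2 X; the 144 = 2 (9) (8) pays for the frequencies k > 0. *)
Lemma mean_swt_part2_sqr_le : 80 <= l -> N%:R <= 4 * (Z%:R ^+ 2 * l) ->
  mean (fun th => swt_part N Z.+1 N.+1 th ^+ 2) <=
  (4 + 144 * K ^+ 3) * (N%:R * l) ^+ 2.
Proof.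
move=> l80 NZ; have N0 := leq_trans Z_gt0 ZN.
under eq_grid_mean => th do rewrite swt_part_fourier //.
rewrite grid_mean_sqr //; set A := \sum_(Z.+1 <= d < N.+1) _.
have A0 : 0 <= A by apply: sumr_ge0 => d _; exact: swt_ge0.
have A2 : A <= 2 * l.
  have := @sum_swt_le R N N0; rewrite (@big_cat_nat _ _ _ Z.+1) //= -/A.
  have : 0 <= \sum_(1 <= d < Z.+1) swt R d by apply: sumr_ge0 => d _; exact: swt_ge0.
  by lra.
have ZR : 0 < Z%:R :> R by rewrite ltr0n.
have NR : 0 < N%:R :> R by rewrite ltr0n.
have K0 := expR_ge0 (8 : R).
have S : \sum_(1 <= k < N.+1) ((N - k)%:R *
    \sum_(Z.+1 <= d < N.+1 | (2 * d %| k)%N) swt R d) ^+ 2 <=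
    N%:R ^+ 2 * (72 * K ^+ 3 * l ^+ 2).
  apply: (@le_trans _ _ (N%:R ^+ 2 * \sum_(1 <= k < N.+1)
    (\sum_(Z.+1 <= d < N.+1 | (2 * d %| k)%N) swt R d) ^+ 2)).
    rewrite mulr_sumr; apply: ler_sum => k _; rewrite exprMn ler_wpM2r ?sqr_ge0 //.
    by rewrite ler_sqr ?nnegrE // ler_nat leq_subr.
  rewrite ler_wpM2l ?sqr_ge0 //.
  have := @sum_sqr_swt_tail_le R N Z; rewrite Z_gt0 ZN => /(_ isT) /le_trans; apply.
  have K3 : 0 <= 9 * K ^+ 3 by rewrite mulr_ge0 // exprn_ge0.
  rewrite ler_pdivrMr ?exprn_gt0 //.
  apply: (@le_trans _ _ (9 * K ^+ 3 * (4 * (Z%:R ^+ 2 * l) * (2 * l)))).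
    by rewrite ler_wpM2l // ler_pM //; lra.
  by rewrite le_eqVlt; apply/orP; left; apply/eqP; ring.
have S1 : (N%:R * A) ^+ 2 <= 4 * (N%:R * l) ^+ 2.
  rewrite (_ : 4 * _ = (N%:R * (2 * l)) ^+ 2); last by ring.
  by rewrite ler_sqr ?nnegrE ?mulr_ge0 //; [rewrite ler_wpM2l | lra].
apply: le_trans (lerD S1 (ler_wpM2l _ S)) _ => //.
by rewrite le_eqVlt; apply/orP; left; apply/eqP; ring.
Qed.

End Moments.

(** * Lower bound for the mean of the exponential sum *)

Section Assembly.
Variable R : realType.

(* [momC] bounds the second moment of the divisors above the cutoff [Z]; [errC] is
   the threshold, in units of [X ^+ 2 * ln N], above which [pair_error] alone makes
   the theorem trivial. *)
Definition momC : R := 4 + 144 * expR 8 ^+ 3.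
(** Chosen so that [tauC / 100 = 48 exp 8] bounds l times the measure of the exceptional set. *)
Definition tauC : R := 4800 * expR 8.
Definition errC : R := (50 * tauC)^-1.
(** 200 stems from halving D / 100, [9 + momC] from the fourth moment, and 25 exceeds 13.3 /
    0.66. *)
Definition lowC : R := 25 * 200 ^+ 3 * (9 + momC).

Lemma tauC_gt0 : 0 < tauC.
Proof. by rewrite /tauC mulr_gt0 ?expR_gt0 ?ltr0n. Qed.

Lemma momC_ge4 : 4 <= momC.
Proof. by rewrite /momC lerDl mulr_ge0 // exprn_ge0 // expR_ge0. Qed.

(* Choosing [lam ^+ 2 = 200 * Q / D] balances the two terms of the hypothesis. *)
Lemma L1_lower_arith (E D X Q L : R) : 0 < X -> 66 / 100 * X <= D -> 0 <= E ->
  Q = 4 * (E + (9 + momC) * X ^+ 2 + 2 * D ^+ 2) -> 0 <= L ->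
  (forall lam : R, 0 < lam -> D / 100 <= lam * L + Q / lam ^+ 2) ->
  X ^+ 3 <= lowC * ((E + X ^+ 2) * L ^+ 2).
Proof.
move=> X0 XD E0 QE L0 H; have m4 := momC_ge4.
have [t t0 tE] : exists2 t : R, 0 < t & t = 200 by exists 200.
have {}H lam : 0 < lam -> 2 * (D / t) <= lam * L + Q / lam ^+ 2.
  by move=> /H; rewrite tE; lra.
rewrite /lowC -tE; clear tE; move: momC m4 QE => m m4 QE.
have D0 : 0 < D by lra.
have X2 : 0 < X ^+ 2 by rewrite exprn_gt0.
have D2 : 0 < D ^+ 2 by rewrite exprn_gt0.
have mX : 0 <= m * X ^+ 2 by apply: mulr_ge0; lra.
have Q0 : 0 < Q by rewrite QE; lra.
have q0 : 0 < t * Q / D by rewrite divr_gt0 // mulr_gt0.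
have [lam lam0 lam2] : exists2 lam : R, 0 < lam & lam ^+ 2 = t * Q / D.
  by exists (Num.sqrt (t * Q / D)); rewrite ?sqrtr_gt0 // sqr_sqrtr // ltW.
have h1 : D / t <= lam * L.
  have := H lam lam0; rewrite lam2 (_ : Q / (t * Q / D) = D / t); first lra.
  by field; rewrite !gt_eqF.
have h2 : D ^+ 3 <= t ^+ 3 * (Q * L ^+ 2).
  have Dt : 0 <= D / t by rewrite divr_ge0 // ltW.
  have : (D / t) ^+ 2 <= (lam * L) ^+ 2.
    by rewrite ler_sqr // nnegrE // (le_trans Dt).
  rewrite [(lam * L) ^+ 2]exprMn lam2 => h.
  have tD : 0 <= t ^+ 2 * D by rewrite mulr_ge0 ?sqr_ge0 // ltW.
  have := ler_wpM2r tD h.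
  rewrite (_ : (D / t) ^+ 2 * (t ^+ 2 * D) = D ^+ 3); last first.
    by field; rewrite gt_eqF.
  rewrite (_ : t * Q / D * L ^+ 2 * (t ^+ 2 * D) = t ^+ 3 * (Q * L ^+ 2)) //.
  by field; rewrite gt_eqF.
have XD2 : X ^+ 2 <= 23 / 10 * D ^+ 2 by nra.
have EX : 0 <= E + X ^+ 2 by lra.
have hQ : Q * X ^+ 2 <= 133 / 10 * ((9 + m) * (D ^+ 2 * (E + X ^+ 2))).
  have a1 : E * X ^+ 2 <= 23 / 10 * (D ^+ 2 * E) by nra.
  have a2 : m * X ^+ 2 * X ^+ 2 <= m * X ^+ 2 * (23 / 10 * D ^+ 2).
    by rewrite ler_wpM2l.
  have a3 : X ^+ 2 * X ^+ 2 <= 23 / 10 * (X ^+ 2 * D ^+ 2) by nra.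
  have m0 : 0 <= m by lra.
  have a6 : 0 <= D ^+ 2 * E by rewrite mulr_ge0 // ltW.
  have a7 : 0 <= D ^+ 2 * X ^+ 2 by rewrite mulr_ge0 // ltW.
  have a4 := mulr_ge0 m0 a6; have a5 := mulr_ge0 m0 a7.
  rewrite QE; lra.
have L2 : 0 <= L ^+ 2 by rewrite sqr_ge0.
have t3 : 0 <= t ^+ 3 by rewrite exprn_ge0 // ltW.
set W := (E + X ^+ 2) * L ^+ 2.
have W0 : 0 <= t ^+ 3 * ((9 + m) * W).
  by apply: mulr_ge0 => //; apply: mulr_ge0; [lra | apply: mulr_ge0].
have h3 : D * X ^+ 2 <= 133 / 10 * (t ^+ 3 * ((9 + m) * W)).
  rewrite -(ler_pM2l D2).
  rewrite (_ : D ^+ 2 * (D * X ^+ 2) = D ^+ 3 * X ^+ 2); last by ring.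
  apply: (@le_trans _ _ (t ^+ 3 * (Q * L ^+ 2) * X ^+ 2)).
    by rewrite ler_wpM2r // ltW.
  rewrite (_ : _ * X ^+ 2 = t ^+ 3 * L ^+ 2 * (Q * X ^+ 2)); last by ring.
  apply: le_trans (ler_wpM2l (mulr_ge0 t3 L2) hQ) _.
  by rewrite le_eqVlt /W; apply/orP; left; apply/eqP; ring.
have h4 : 66 / 100 * X ^+ 3 <= D * X ^+ 2.
  rewrite (_ : 66 / 100 * X ^+ 3 = 66 / 100 * X * X ^+ 2); last by ring.
  by rewrite ler_wpM2r // ltW.
rewrite -[leRHS]mulrA -[leRHS]mulrA; move: W0 h3; set Y := t ^+ 3 * _.
by move=> W0 h3; lra.
Qed.

End Assembly.

(** * The lower bound on a fixed grid *)

Section GridLowerBound.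
Variable R : realType.
Local Notation K := (expR 8 : R).

(* Pointwise form of Hoelder's inequality between the exponents 1, 2 and 4. *)
Lemma le_sqrt_sqr (lam s : R) : 0 < lam -> 0 <= s ->
  s <= lam * Num.sqrt s + s ^+ 2 / lam ^+ 2.
Proof.
move=> lam0 s0; have f0 := sqrtr_ge0 s; have := sqr_sqrtr s0.
set f := Num.sqrt s in f0 * => fs.
have [fl|fl] := leP f lam.
  have h : 0 <= s ^+ 2 / lam ^+ 2 by rewrite divr_ge0 ?sqr_ge0.
  by rewrite -fs in h *; nra.
have lf : lam ^+ 2 <= s by rewrite -fs; nra.
have h : s <= s ^+ 2 / lam ^+ 2.
  by rewrite ler_pdivlMr ?exprn_gt0 // expr2 ler_wpM2l.
by apply: le_trans h _; rewrite lerDr mulr_ge0 // ltW.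
Qed.

Lemma sqr_sum4_le (a b c d : R) :
  (a + b + c + d) ^+ 2 <= 4 * (a ^+ 2 + b ^+ 2 + c ^+ 2 + d ^+ 2).
Proof.
have := sqr_ge0 (a - b); have := sqr_ge0 (a - c); have := sqr_ge0 (a - d).
have := sqr_ge0 (b - c); have := sqr_ge0 (b - d); have := sqr_ge0 (c - d).
by rewrite !expr2; nra.
Qed.

Lemma mul_le_sqr_div (tau x : R) : 0 < tau -> x <= x ^+ 2 / (2 * tau) + tau / 2.
Proof.
move=> t0; rewrite -subr_ge0.
have -> : x ^+ 2 / (2 * tau) + tau / 2 - x = (x - tau) ^+ 2 / (2 * tau).
  by field; rewrite gt_eqF.
by rewrite divr_ge0 ?sqr_ge0 // mulr_ge0 // ltW.
Qed.

Lemma grid_L1_lower (N Z J M : nat) :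
  let l := ln N%:R : R in let X := N%:R * l in
  (0 < Z <= N)%N -> (0 < J)%N -> (2 * N * J.+1 < M)%N -> (J * Z <= 2 * N)%N ->
  10 ^+ 7 <= l -> 500 * (tauC R * momC R) <= l ->
  Z%:R ^+ 2 * l <= N%:R -> N%:R <= 4 * (Z%:R ^+ 2 * l) -> X <= J%:R ^+ 2 ->
  pair_error R N <= errC R * (X ^+ 2 * l) ->
  X ^+ 3 <= lowC R * ((pair_error R N + X ^+ 2) *
    grid_mean M (fun th => Num.sqrt (sqS N th)) ^+ 2).
Proof.
move=> l X /andP[Z0 ZN] J0 NM JZ l7 lm Zl NZ XJ EX.
have M0 : (0 < M)%N by exact: leq_ltn_trans NM.
have N0 : (0 < N)%N := leq_trans Z0 ZN.
have NR : 0 < N%:R :> R by rewrite ltr0n.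
have ZR : 1 <= Z%:R :> R by rewrite ler1n.
have DX : 66 / 100 * X <= sum_sqr R N := sum_vonMangoldt_sqr_ge l7.
have hA : 40 <= l / 1000.
  rewrite ler_pdivlMr ?ltr0n //; apply: le_trans l7.
  rewrite (_ : 10 ^+ 7 = 10 * 1000 * 1000); last by ring.
  by rewrite ler_wpM2r ?ler0n //; lra.
clear l7; have l80 : 80 <= l by lra.
have lgt0 : 0 < l by lra.
have X0 : 0 < X by rewrite mulr_gt0.
have m4 := momC_ge4 R; have t0 := tauC_gt0 R.
set D := sum_sqr R N in DX *; set E := pair_error R N in EX *.
have E0 : 0 <= E.
  by rewrite /E pair_errorE mulr_ge0 // sumr_ge0 // => k _; exact: sqr_ge0.
have D0 : 0 < D by lra.
pose B th : R := 2 * \sum_(1 <= k < N.+1) err R N k * cos (k%:R * th).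
pose V1 := @swt_part R N 1 Z.+1; pose V2 := @swt_part R N Z.+1 N.+1.
pose A : R := \sum_(1 <= d < N.+1) swt R d; pose c0 : R := D - N%:R * A.
pose bad th : R := (X < V1 th)%R%:R.
have dec th : sqS N th = B th + V1 th + V2 th + c0 by exact: sqS_decomp.
have mB : grid_mean M (fun th => B th ^+ 2) = E by exact: (mean_err_sqr R NM).
have mV1 : grid_mean M V1 <= N%:R * (5 / 8 * l) + X / 1000.
  rewrite (mean_swt_part1 R Z0 ZN J0 NM).
  have h1 := @sum_swt_le R Z Z0.
  (* Z^2 l <= N puts Z below sqrt N, which halves the coefficient 5/4 to 5/8. *)
  have h2 : 2 * ln Z%:R <= l.
    have Z2 : Z%:R ^+ 2 <= N%:R :> R.
      by apply: le_trans Zl; rewrite ler_peMr ?sqr_ge0 //; lra.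
    have Zgt0 : 0 < Z%:R :> R by rewrite ltr0n.
    by rewrite mulr_natl -lnXn // /l ler_ln ?posrE ?exprn_gt0.
  have : N%:R * \sum_(1 <= d < Z.+1) swt R d <= N%:R * (5 / 8 * l + l / 1000).
    by rewrite ler_wpM2l ?(ltW NR) //; lra.
  by move/le_trans; apply; rewrite mulrDr /X [_ * (l / 1000)]mulrA.
have mV2 : grid_mean M (fun th => V2 th ^+ 2) <= momC R * X ^+ 2.
  exact: (mean_swt_part2_sqr_le Z0 ZN NM l80 NZ).
have mS : grid_mean M (sqS N) = D by exact: (mean_sqS R Z0 ZN J0 NM).
(* J Z <= 2 N bounds X times the measure by 48 exp(8) N; dividing by N leaves the factor l. *)
have mbad : l * grid_mean M bad <= tauC R / 100.
  have := mean_large_le ZN J0 NM X0 XJ; rewrite -/V1 -/bad => h.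
  have JZR : (J * Z)%:R <= 2 * N%:R :> R by rewrite -natrM ler_nat.
  rewrite -(ler_pM2l NR) mulrA -/X; apply: le_trans h _.
  have K0 : 0 <= 24 * K by rewrite mulr_ge0 ?expR_ge0.
  have := ler_wpM2l K0 JZR; rewrite /tauC; lra.
have A0 : 0 <= A by apply: sumr_ge0 => d _; exact: swt_ge0.
have NA0 : 0 <= N%:R * A by rewrite mulr_ge0.
have NA : N%:R * A <= 2 * X.
  have h : A <= 2 * l by have := @sum_swt_le R N N0; rewrite -/A -/l; lra.
  by rewrite /X mulrCA ler_wpM2l // ltW.
have V1ge th : 0 <= V1 th.
  rewrite /V1 /swt_part big_nat_cond; apply: sumr_ge0 => d /andP[/andP[d0 _] _].
  by rewrite mulr_ge0 ?swt_ge0 ?modker_ge0 ?muln_gt0.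
have sq0 (th : R) : 0 <= sqS N th by rewrite addr_ge0 ?sqr_ge0.
have good : D / 100 <= grid_mean M (fun th => sqS N th * (1 - bad th)).
  (* Balances two costs of at most X / 100: E / (2 tau), by the choice of [errC], and tau times the
     measure, by [mbad]. *)
  pose tau : R := X * l / tauC R.
  have tau0 : 0 < tau by rewrite divr_gt0 // mulr_gt0.
  (* On the exceptional set B and V2 are linearised at height tau, c0 is at most D, and V1 is
     charged with its full mean. *)
  have pw th : sqS N th * bad th <= (2 * tau)^-1 * (B th ^+ 2 + V2 th ^+ 2) +
      V1 th + (tau + D) * bad th.
    have it0 : 0 <= (2 * tau)^-1 by rewrite invr_ge0 mulr_ge0 // ltW.
    rewrite /bad; case: ltP => _; last first.
      by rewrite !mulr0 addr0 addr_ge0 // mulr_ge0 // addr_ge0 ?sqr_ge0.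
    have := mul_le_sqr_div (B th) tau0; have := mul_le_sqr_div (V2 th) tau0.
    by rewrite !mulr1 mulrDr dec /c0 ![_ ^+ 2 / _]mulrC; lra.
  have mSb := ler_grid_mean M pw.
  rewrite !grid_meanD !grid_meanZ grid_meanD mB in mSb.
  have -> : grid_mean M (fun th => sqS N th * (1 - bad th)) =
      D - grid_mean M (fun th => sqS N th * bad th).
    rewrite -mS -mulN1r -grid_meanZ -grid_meanD; apply: eq_grid_mean => th.
    by ring.
  have b1 : (2 * tau)^-1 * (E + grid_mean M (fun th => V2 th ^+ 2)) <=
      X / 100 + X / 1000.
    apply: (@le_trans _ _ ((2 * tau)^-1 * (errC R * (X ^+ 2 * l) + momC R * X ^+ 2))).
      by rewrite ler_wpM2l ?lerD // invr_ge0 mulr_ge0 // ltW.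
    have -> : (2 * tau)^-1 * (errC R * (X ^+ 2 * l) + momC R * X ^+ 2) =
        X / 100 + X * (tauC R * momC R) / (2 * l).
      by rewrite /tau /errC; field; rewrite !gt_eqF.
    rewrite lerD2l ler_pdivrMr ?mulr_gt0 //.
    have := ler_wpM2l (ltW X0) lm; lra.
  have b2 : grid_mean M bad <= 1 / 1000.
    rewrite -(ler_pM2l lgt0); apply: le_trans mbad _.
    have : tauC R * 4 <= tauC R * momC R by rewrite ler_wpM2l // ltW.
    lra.
  have b3 : tau * grid_mean M bad <= X / 100.
    rewrite (_ : tau * _ = X / tauC R * (l * grid_mean M bad)); last first.
      by rewrite /tau; field; rewrite gt_eqF.
    apply: (@le_trans _ _ (X / tauC R * (tauC R / 100))).
      by rewrite ler_wpM2l // divr_ge0 // ltW.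
    by rewrite le_eqVlt; apply/orP; left; apply/eqP; field; rewrite gt_eqF.
  have b4 := ler_wpM2l (ltW D0) b2.
  have b5 : grid_mean M V1 <= 5 / 8 * X + X / 1000.
    by apply: le_trans mV1 _; rewrite /X mulrCA.
  (* The exceptional set carries at most 0.647 X + 0.001 D, and X <= D / 0.66 makes this less than
     0.99 D. *)
  have fin (s a b c v d x : R) : 0 < d -> s <= a + v + (b + c) -> a <= x / 100 + x / 1000 ->
      b <= x / 100 -> c <= d * (1 / 1000) -> v <= 5 / 8 * x + x / 1000 ->
      66 / 100 * x <= d -> d / 100 <= d - s by lra.
  rewrite [(tau + D) * _]mulrDl in mSb; exact: fin D0 mSb b1 b3 b4 b5 DX.
apply: (L1_lower_arith X0 DX E0 (erefl _)).
  by rewrite -[leLHS](grid_mean_cst M0) ler_grid_mean // => th; exact: sqrtr_ge0.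
move=> lam lam0; apply: le_trans good _.
have lam2 : 0 < lam ^+ 2 by rewrite exprn_gt0.
apply: (@le_trans _ _ (grid_mean M (fun th => lam * Num.sqrt (sqS N th) +
   4 / lam ^+ 2 * (B th ^+ 2 + V2 th ^+ 2 + (X ^+ 2 + c0 ^+ 2))))).
  apply: ler_grid_mean => th.
  have S0 : 0 <= B th ^+ 2 + V2 th ^+ 2 + (X ^+ 2 + c0 ^+ 2).
    by rewrite !addr_ge0 ?sqr_ge0.
  have c40 : 0 <= 4 / lam ^+ 2 by rewrite divr_ge0 // ltW.
  rewrite /bad; case: ltP => XV.
    rewrite subrr mulr0 addr_ge0 //; first by rewrite mulr_ge0 ?sqrtr_ge0 ?ltW.
    exact: mulr_ge0.
  rewrite mulr0n subr0 [leLHS]mulr1; have h := le_sqrt_sqr lam0 (sq0 th).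
  apply: le_trans h _.
  rewrite lerD2l [4 / _ * _]mulrAC ler_wpM2r ?invr_ge0 ?(ltW lam2) // {1}dec.
  apply: le_trans (sqr_sum4_le _ _ _ _) _; rewrite ler_wpM2l //.
  have : V1 th ^+ 2 <= X ^+ 2 by rewrite ler_sqr ?nnegrE // ltW.
  lra.
rewrite grid_meanD grid_meanZ lerD2l grid_meanZ !grid_meanD mB !grid_mean_cst //.
rewrite [4 / _ * _]mulrAC ler_wpM2r ?invr_ge0 ?(ltW lam2) // ler_wpM2l //.
(* The N A subtracted from D lies between 0 and 2 X, so |c0| <= D + 2 X. The 8 joins the X^2 coming
   from V1 <= X to form the 9 of [9 + momC]. *)
have : c0 ^+ 2 <= 2 * D ^+ 2 + 8 * X ^+ 2.
  have : c0 ^+ 2 <= (D + 2 * X) ^+ 2.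
    rewrite -subr_ge0 subr_sqr; apply: mulr_ge0; rewrite /c0; lra.
  have := sqr_ge0 (D - 2 * X); rewrite !expr2; lra.
lra.
Qed.

End GridLowerBound.

(** * From the grid to the integral *)

Section RiemannSums.
Variable R : realType.
Local Notation mu := (@lebesgue_measure R).

Lemma lipschitz_deriv_le1 (f df : R -> R) :
  (forall x, is_derive x (1 : R) f (df x)) -> (forall x, `|df x| <= 1) ->
  forall x y, `|f x - f y| <= `|x - y|.
Proof.
move=> fd df1; have main x y : x <= y -> `|f y - f x| <= `|y - x|.
  move=> xy; have [|c _ ->] :=  @MVT_segment R f df x y xy.
    apply: continuous_subspaceT => z.
    by apply/differentiable_continuous/derivable1_diffP; case: (fd z).
  by rewrite normrM ler_piMl.
move=> x y; have [/main|/ltW/main//] := leP x y.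
by rewrite distrC [`|y - x|]distrC.
Qed.

Lemma lipschitz_cos (x y : R) : `|cos x - cos y| <= `|x - y|.
Proof.
apply: (@lipschitz_deriv_le1 cos (fun z => - sin z)) => z.
by rewrite normrN ler_norml sin_geN1 sin_le1.
Qed.

Lemma lipschitz_sin (x y : R) : `|sin x - sin y| <= `|x - y|.
Proof.
apply: (@lipschitz_deriv_le1 sin cos) => z.
by rewrite ler_norml cos_geN1 cos_le1.
Qed.

Lemma sqrt_sqr2_le (a b a' b' : R) :
  Num.sqrt (a ^+ 2 + b ^+ 2) <=
  Num.sqrt (a' ^+ 2 + b' ^+ 2) + (`|a - a'| + `|b - b'|).
Proof.
set r := Num.sqrt (a' ^+ 2 + _).
have S0 (x y : R) : 0 <= x ^+ 2 + y ^+ 2 by rewrite addr_ge0 ?sqr_ge0.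
have r0 : 0 <= r by exact: sqrtr_ge0.
have r2 : r ^+ 2 = a' ^+ 2 + b' ^+ 2 by rewrite sqr_sqrtr.
have ra : `|a'| <= r.
  rewrite -ler_sqr ?nnegrE ?normr_ge0 // r2 real_normK ?num_real //.
  by rewrite lerDl sqr_ge0.
have rb : `|b'| <= r.
  rewrite -ler_sqr ?nnegrE ?normr_ge0 // r2 real_normK ?num_real //.
  by rewrite lerDr sqr_ge0.
have u0 := normr_ge0 (a - a'); have v0 := normr_ge0 (b - b').
have u2 : `|a - a'| ^+ 2 = (a - a') ^+ 2 by rewrite real_normK ?num_real.
have v2 : `|b - b'| ^+ 2 = (b - b') ^+ 2 by rewrite real_normK ?num_real.
have ua : a' * (a - a') <= r * `|a - a'|.
  by apply: le_trans (ler_norm _) _; rewrite normrM ler_wpM2r.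
have vb : b' * (b - b') <= r * `|b - b'|.
  by apply: le_trans (ler_norm _) _; rewrite normrM ler_wpM2r.
rewrite -ler_sqr ?nnegrE ?sqrtr_ge0 ?addr_ge0 // sqr_sqrtr //.
have := mulr_ge0 u0 v0; nra.
Qed.

Lemma expsum_normc N (alpha : R) :
  Normc.normc (expsum N alpha) = Num.sqrt (sqS N (2 * pi * alpha)).
Proof.
have -> : expsum N alpha =
   Complex (\sum_(1 <= n < N.+1) vonMangoldt R n * cos (n%:R * (2 * pi * alpha)))
           (\sum_(1 <= n < N.+1) vonMangoldt R n * sin (n%:R * (2 * pi * alpha))).
  rewrite /expsum; elim: N => [|N IH]; first by rewrite !big_geq.
  rewrite !(@big_nat_recr _ _ _ N.+1 1) //= IH /exp2pii mulrCA.
  apply/eqP; rewrite eq_complex /=; apply/andP; split; apply/eqP; ring.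
by [].
Qed.

(** The constant grows with N, which is harmless: N stays fixed while M tends to infinity. *)
Lemma sqrt_sqS_lipschitz N (x y : R) :
  Num.sqrt (sqS N x) <= Num.sqrt (sqS N y) +
    2 * (\sum_(1 <= n < N.+1) vonMangoldt R n * n%:R) * `|x - y|.
Proof.
rewrite /sqS; set a := \sum_(1 <= n < _) _; set b := \sum_(1 <= n < _) _.
set a' := \sum_(1 <= n < _) _; set b' := \sum_(1 <= n < _) _.
apply: le_trans (sqrt_sqr2_le a b a' b') _; rewrite lerD2l.
have H (h : R -> R) : (forall u v, `|h u - h v| <= `|u - v|) ->
    `|\sum_(1 <= n < N.+1) vonMangoldt R n * h (n%:R * x) -
      \sum_(1 <= n < N.+1) vonMangoldt R n * h (n%:R * y)| <=
    (\sum_(1 <= n < N.+1) vonMangoldt R n * n%:R) * `|x - y|.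
  move=> hl; rewrite -sumrB mulr_suml; apply: le_trans (ler_norm_sum _ _ _) _.
  apply: ler_sum => n _; rewrite -mulrBr normrM ger0_norm ?vonMangoldt_ge0 //.
  rewrite -mulrA ler_wpM2l ?vonMangoldt_ge0 //; apply: le_trans (hl _ _) _.
  by rewrite -mulrBr normrM normr_nat.
by have := H _ lipschitz_cos; have := H _ lipschitz_sin; lra.
Qed.

Lemma continuous_of_lipschitz (f : R -> R) (c : R) :
  (forall x y, f x <= f y + c * `|x - y|) -> continuous f.
Proof.
move=> H x; apply/cvgrPdist_lt => e e0.
have c0 : 0 < `|c| + 1 by rewrite ltr_wpDl.
near=> y.
have d : `|x - y| < e / (`|c| + 1) by near: y; apply: cvgr_dist_lt => //; rewrite divr_gt0.
have cd : c * `|x - y| < e.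
  rewrite ltr_pdivlMr // in d; apply: le_lt_trans d; rewrite mulrC ler_wpM2l //.
  by rewrite (le_trans (ler_norm c)) // lerDl.
have := H x y; have := H y x; rewrite [`|y - x|]distrC ltr_norml => h1 h2.
by apply/andP; split; lra.
Unshelve. all: by end_near.
Qed.

(** On each cell f is at least its left value minus |c| / M. Only this direction is required, the
    goal being a lower bound for the integral. *)
Lemma Rintegral_ge_left_sum (f : R -> R) (c : R) (M : nat) : (0 < M)%N ->
  (forall x, 0 <= f x) -> (forall x y, f x <= f y + c * `|x - y|) ->
  M%:R^-1 * \sum_(0 <= j < M) f (j%:R / M%:R) - `|c| / M%:R <=
  \int[mu]_(x in `[0, 1]) f x.
Proof.
move=> M0 f0 fl; have MR : 0 < M%:R :> R by rewrite ltr0n.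
have fc : continuous f by exact: continuous_of_lipschitz fl.
have fint (a b : R) : mu.-integrable `[a, b] (EFin \o f).
  apply: continuous_compact_integrable; first exact: segment_compact.
  exact: continuous_subspaceT.
have step (j : nat) : M%:R^-1 * \sum_(0 <= i < j) (f (i%:R / M%:R) - `|c| / M%:R) <=
    \int[mu]_(x in `[0, j%:R / M%:R]) f x.
  elim: j => [|j IH]; first by rewrite big_geq // mulr0 Rintegral_ge0.
  pose a : R := j%:R / M%:R; pose b : R := j.+1%:R / M%:R.
  have ab : a <= b by rewrite ler_wpM2r ?invr_ge0 // ler_nat.
  have ba : b - a = M%:R^-1 by rewrite -mulrBl -natrB // subSnn mul1r.
  have a0 : 0 <= a by rewrite divr_ge0.
  rewrite big_nat_recr //= mulrDr -/a -/b.
  have sub : [set` Interval (BRight a) (BRight b)] `<=` `[a, b]%classic.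
    by apply: subset_itvr; rewrite bnd_simp.
  have mI : measurable [set` Interval (BRight a) (BRight b)] by [].
  rewrite -[leRHS](subrK (\int[mu]_(x in `[0, a]) f x)) [leRHS]addrC lerD //.
  rewrite (@Rintegral_itvB _ f (BLeft 0) (BRight b) a) ?bnd_simp //.
  have -> : M%:R^-1 * (f a - `|c| / M%:R) =
      \int[mu]_(x in [set` Interval (BRight a) (BRight b)]) (f a - `|c| / M%:R).
    have mE : mu [set` Interval (BRight a) (BRight b)] = (b - a)%:E.
      have := @lebesgue_measure_itv R (Interval (BRight a) (BRight b)).
      rewrite /= lte_fin /a /b ltr_pM2r ?invr_gt0 // ltr_nat ltnSn => ->.
      by rewrite -EFinB.
    by rewrite Rintegral_cst // [X in fine X]mE /= ba mulrC.
  apply: le_Rintegral => //.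
  - apply: (@integrableS _ _ _ mu `[a, b]%classic) => //.
    apply: continuous_compact_integrable; first exact: segment_compact.
    by apply: continuous_subspaceT => z; exact: cvg_cst.
  - by apply: (@integrableS _ _ _ mu `[a, b]%classic).
  move=> x /=; rewrite in_itv /= => /andP[ax xb].
  have := fl a x; rewrite ltr0_norm ?subr_lt0 // opprB => h.
  have : c * (x - a) <= `|c| / M%:R.
    apply: (@le_trans _ _ (`|c| * (x - a))).
      by rewrite ler_wpM2r ?ler_norm // subr_ge0 ltW.
    by rewrite ler_wpM2l // -ba lerB.
  by lra.
have := step M; rewrite divff ?gt_eqF // sumrB sumr_const_nat subn0 mulrBr.
by rewrite -[X in _ - _ * X]mulr_natl mulKf ?gt_eqF.
Qed.

End RiemannSums.

(** * Choice of the cutoffs and the limit in M *)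

Section L1Norm.
Variable R : realType.

(** Z is y = sqrt(N / l) rounded down and J is x = sqrt(N l) rounded up. Since x y = N, rounding
    costs only constants: J Z <= (x + 1) y <= 2 N, and y < Z + 1 <= 2 Z. *)
Lemma cutoffs_exist (N : nat) : let l := ln N%:R : R in 1 <= l ->
  exists Z J : nat, [/\ (0 < Z <= N)%N, (0 < J)%N, (J * Z <= 2 * N)%N,
    Z%:R ^+ 2 * l <= N%:R & N%:R <= 4 * (Z%:R ^+ 2 * l) /\
    N%:R * l <= J%:R ^+ 2].
Proof.
move=> l l1; have l0 : 0 < l by lra.
have N0 : (0 < N)%N.
  by rewrite lt0n; apply/eqP => N0; move: l0; rewrite /l N0 ln0 ?ltxx.
have NR : 0 < N%:R :> R by rewrite ltr0n.
have N1 : 1 <= N%:R :> R by rewrite ler1n.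
have lN : l < N%:R by exact: ln_sublinear.
pose y : R := Num.sqrt (N%:R / l); pose x : R := Num.sqrt (N%:R * l).
have y0 : 0 <= y by exact: sqrtr_ge0.
have x0 : 0 <= x by exact: sqrtr_ge0.
have y2 : y ^+ 2 * l = N%:R.
  by rewrite sqr_sqrtr ?divr_ge0 ?ltW // divfK // gt_eqF.
have x2 : x ^+ 2 = N%:R * l by rewrite sqr_sqrtr // mulr_ge0 ?ltW.
have xy : x * y = N%:R.
  rewrite -sqrtrM; last by rewrite mulr_ge0 // ltW.
  rewrite (_ : _ * _ = N%:R ^+ 2); first by rewrite sqrtr_sqr ger0_norm.
  by field; rewrite gt_eqF.
have y1 : 1 <= y.
  by rewrite -[leLHS]sqrtr1 ler_wsqrtr // ler_pdivlMr // mul1r ltW.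
have yN : y <= N%:R by nra.
pose Z := Num.truncn y; pose J := (Num.truncn x).+1.
have Zy : Z%:R <= y by rewrite truncn_le.
have yZ : y < Z.+1%:R by exact: truncnS_gt.
have Jx : J%:R <= x + 1 by rewrite -natr1 lerD2r truncn_le.
have xJ : x < J%:R by exact: truncnS_gt.
have Z0 : (0 < Z)%N by rewrite -(ltr_nat R); move: yZ; rewrite -natr1; lra.
have ZR : 1 <= Z%:R :> R by rewrite ler1n.
exists Z, J; split=> //.
- by rewrite Z0 -(ler_nat R) (le_trans Zy).
- rewrite -(ler_nat R) !natrM; have J0 : 0 <= J%:R :> R by [].
  apply: (@le_trans _ _ ((x + 1) * y)); first by rewrite ler_pM.
  by rewrite mulrDl xy; lra.
- by rewrite -[leRHS]y2; apply: ler_wpM2r; rewrite ?(ltW l0) // ler_sqr ?nnegrE.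
split; last by rewrite -x2 ler_sqr ?nnegrE // ltW.
rewrite -[leLHS]y2 mulrA ler_wpM2r ?(ltW l0) //.
rewrite (_ : 4 * Z%:R ^+ 2 = (2 * Z%:R) ^+ 2); last by ring.
by rewrite ler_sqr ?nnegrE ?mulr_ge0 //; move: yZ; rewrite -natr1; lra.
Qed.

Lemma L1_norm_lower (N : nat) :
  let l := ln N%:R : R in let X := N%:R * l in
  10 ^+ 7 <= l -> 500 * (tauC R * momC R) <= l ->
  pair_error R N <= errC R * (X ^+ 2 * l) ->
  X ^+ 3 <= lowC R * ((pair_error R N + X ^+ 2) *
    (\int[lebesgue_measure]_(alpha in `[0, 1]) Normc.normc (expsum N alpha)) ^+ 2).
Proof.
move=> l X l7 lm EX.
have l1 : 1 <= l by apply: le_trans l7; rewrite exprn_ege1 // ler1n.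
have [Z [J [ZN J0 JZ Zl [NZ XJ]]]] := cutoffs_exist l1.
under eq_Rintegral => alpha _ do rewrite expsum_normc.
set I := Rintegral _ _ _; set E := pair_error R N in EX *.
have I0 : 0 <= I by apply: Rintegral_ge0 => x _; exact: sqrtr_ge0.
have N0 : 0 < N%:R :> R by rewrite ltr0n; case/andP: ZN => a /(leq_trans a).
have X0 : 0 < X by rewrite mulr_gt0 //; lra.
have E0 : 0 <= E.
  by rewrite /E pair_errorE mulr_ge0 // sumr_ge0 // => k _; exact: sqr_ge0.
have low0 : 0 < lowC R.
  rewrite /lowC; have := momC_ge4 R => m4; rewrite mulr_gt0 ?mulr_gt0 ?exprn_gt0 ?ltr0n //.
  by lra.
pose Y := lowC R * (E + X ^+ 2).
have Y0 : 0 < Y by rewrite mulr_gt0 // ltr_wpDl // exprn_gt0.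
pose b : R := Num.sqrt (X ^+ 3 / Y).
have b0 : 0 <= b by exact: sqrtr_ge0.
have b2 : b ^+ 2 = X ^+ 3 / Y by rewrite sqr_sqrtr // divr_ge0 ?exprn_ge0 // ltW.
pose c : R := 2 * (\sum_(1 <= n < N.+1) vonMangoldt R n * n%:R) * `|2 * pi|.
have lip (x y : R) : Num.sqrt (sqS N (2 * pi * x)) <=
    Num.sqrt (sqS N (2 * pi * y)) + c * `|x - y|.
  by rewrite /c -[X in _ + X]mulrA -normrM mulrBr; exact: sqrt_sqS_lipschitz.
(* b depends on N but not on M, so the discretisation error |c| / M can be made smaller than any
   e. *)
suff bI : b <= I.
  rewrite mulrA -/Y -ler_pdivrMl // mulrC -b2.
  by rewrite ler_sqr ?nnegrE.
apply/ler_addgt0Pr => e e0.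
pose M := maxn (2 * N * J.+1).+1 (Num.truncn (`|c| / e)).+1.
have M0 : (0 < M)%N by rewrite /M leq_max.
have MR : 0 < M%:R :> R by rewrite ltr0n.
have NM : (2 * N * J.+1 < M)%N by rewrite /M leq_max leqnn.
have cM : `|c| / M%:R <= e.
  rewrite ler_pdivrMr // mulrC -ler_pdivrMr //.
  by rewrite (le_trans (ltW (truncnS_gt _))) // ler_nat /M leq_max leqnn orbT.
have := grid_L1_lower ZN J0 NM JZ l7 lm Zl NZ XJ EX.
rewrite -/E mulrA -/Y; set m := grid_mean M _ => hm.
have m0 : 0 <= m.
  rewrite /m /grid_mean mulr_ge0 ?invr_ge0 // sumr_ge0 // => j _; exact: sqrtr_ge0.
have bm : b <= m by rewrite -ler_sqr ?nnegrE // b2 ler_pdivrMr // mulrC.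
have := Rintegral_ge_left_sum M0 (fun x => sqrtr_ge0 (sqS N (2 * pi * x))) lip.
rewrite -/I -[M%:R^-1 * _]/m; lra.
Qed.

End L1Norm.

(** Two cases, according to whether E(N) exceeds [errC] X^2 l. Below the threshold the bound on the
    integral applies and the added term only helps; above it the integral is discarded and T^2 >= N
    gives E T^2 >= [errC] X^3. *)
Theorem theorem4 (R : realType) :
  exists C c : R, [/\ 0 < C, 0 < c &
    \forall N \near \oo,
      (pair_error R N + N%:R ^+ 2 * ln N%:R ^+ 2) *
      (\int[lebesgue_measure]_(alpha in `[0, 1]) Normc.normc (expsum N alpha) +
         C * (Num.sqrt N%:R * Num.sqrt (ln (ln N%:R)))) ^+ 2
      >= c * (N%:R ^+ 3 * ln N%:R ^+ 3)].
Proof.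
have low0 : 0 < lowC R.
  rewrite /lowC; have := momC_ge4 R => m4; rewrite mulr_gt0 ?mulr_gt0 ?exprn_gt0 ?ltr0n //.
  by lra.
have err0 : 0 < errC R by rewrite invr_gt0 mulr_gt0 ?tauC_gt0 ?ltr0n.
exists 1, (Num.min (lowC R)^-1 (errC R)); split=> //.
  by rewrite lt_min invr_gt0 low0.
have tm0 : 0 <= 500 * (tauC R * momC R).
  apply: mulr_ge0; first exact: ler0n.
  by apply: mulr_ge0; [exact: ltW (tauC_gt0 R) | exact: le_trans (momC_ge4 R)].
(* The three terms serve Chebyshev's bound, the smallness of V2 on the exceptional set, and log log
   N >= 1. *)
pose L0 : R := 10 ^+ 7 + 500 * (tauC R * momC R) + expR 1.
exists (Num.truncn (expR L0)).+1 => // N /= hN.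
have LN : expR L0 <= N%:R.
  by apply: le_trans (ltW (truncnS_gt _)) _; rewrite ler_nat.
have NR : 0 < N%:R :> R by apply: lt_le_trans LN; exact: expR_gt0.
have hl : L0 <= ln N%:R by rewrite -ler_expR lnK.
have t7 : 0 <= 10 ^+ 7 :> R by rewrite exprn_ge0.
have e1 := expR_gt0 (1 : R).
set l := ln N%:R in hl *; set X := N%:R * l.
have l7 : 10 ^+ 7 <= l.
  apply: le_trans hl; rewrite /L0 -addrA lerDl addr_ge0 // ltW //.
have lm : 500 * (tauC R * momC R) <= l.
  by apply: le_trans hl; rewrite /L0 -addrA addrCA lerDl addr_ge0 // ltW.
have le : expR 1 <= l by apply: le_trans hl; rewrite /L0 lerDr addr_ge0.
have l0 : 0 < l by apply: lt_le_trans le.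
have ll1 : 1 <= ln l by rewrite -ler_expR lnK.
set E := pair_error R N; set I := Rintegral _ _ _.
rewrite -!exprMn -/X mul1r.
have X0 : 0 < X by rewrite mulr_gt0.
have X3 : 0 <= X ^+ 3 by rewrite exprn_ge0 // ltW.
have E0 : 0 <= E.
  by rewrite /E pair_errorE mulr_ge0 // sumr_ge0 // => k _; exact: sqr_ge0.
have I0 : 0 <= I by apply: Rintegral_ge0 => x _; rewrite expsum_normc sqrtr_ge0.
have EX0 : 0 <= E + X ^+ 2 by rewrite addr_ge0 // sqr_ge0.
set T := Num.sqrt _ * Num.sqrt _.
have T0 : 0 <= T by rewrite mulr_ge0 ?sqrtr_ge0.
have [EX|EX] := leP E (errC R * (X ^+ 2 * l)).
  have h := L1_norm_lower l7 lm EX; rewrite -/X -/E -/I in h.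
  apply: (@le_trans _ _ ((lowC R)^-1 * X ^+ 3)).
    by rewrite ler_wpM2r // ge_min lexx.
  rewrite ler_pdivrMl //; apply: le_trans h _; rewrite ler_pM2l // ler_wpM2l //.
  by rewrite ler_sqr ?nnegrE ?addr_ge0 // lerDl.
apply: (@le_trans _ _ (errC R * X ^+ 3)).
  by rewrite ler_wpM2r // ge_min lexx orbT.
have T2 : N%:R <= T ^+ 2.
  rewrite /T exprMn !sqr_sqrtr ?(ltW NR) //; last by lra.
  by rewrite ler_peMr // ltW.
apply: (@le_trans _ _ (E * T ^+ 2)).
  apply: (@le_trans _ _ (E * N%:R)); last by rewrite ler_wpM2l.
  rewrite (_ : errC R * X ^+ 3 = errC R * (X ^+ 2 * l) * N%:R).
    by rewrite ler_wpM2r ?ltW.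
  by rewrite /X; ring.
rewrite ler_pM ?sqr_ge0 //; first by rewrite lerDl sqr_ge0.
by rewrite ler_sqr ?nnegrE ?addr_ge0 // lerDr.
Qed.
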